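(* Let $X$ be a complete $c_X$-quasiconvex metric space and $Y$ a complete $c_Y$-quasiconvex metric space. Let $G\subsetneq X$ be a non-point-cut and locally $a$-John domain, and let $G'\subsetneq Y$ be a $b_1$-uniform and locally $a'$-John domain. Let $f:G\to G'$ be an $M$-quasihyperbolic homeomorphism with $M\ge1$. If $D\subset G$ is a $b_2$-uniform subdomain, then $D'=f(D)$ is $b'$-uniform, where the constant $b'$ depends only on $c_X$, $c_Y$, $a$, $a'$, $b_1$, $b_2$ and $M$.
   Context: The distance between points $x,y$ of a metric space is written $|x-y|$. A domain is a nonempty open connected subset. For a domain $G\subsetneq X$ in a connected metric space $X$ (so that $\partial G\neq\emptyset$), $\delta_G(z)$ denotes the distance from $z\in G$ to the boundary $\partial G$. $\ell(\gamma)$ denotes the length of an arc $\gamma$, and $\gamma[x,z]$ denotes the part of $\gamma$ between $x$ and $z$. $\mathbb{B}(x,r)=\{y\in X:|x-y|<r\}$. A metric space $X$ is $c$-quasiconvex ($c\ge1$) if each pair of points $x,y\in X$ can be joined by an arc $\gamma$ with $\ell(\gamma)\le c|x-y|$. A domain $G\subsetneq X$ is $b$-uniform if each pair of points $x,y\in G$ can be joined by a rectifiable arc $\gamma$ in $G$ such that (1) $\min\{\ell(\gamma[x,z]),\ell(\gamma[z,y])\}\le b\,\delta_G(z)$ for all $z\in\gamma$, and (2) $\ell(\gamma)\le b|x-y|$. If each pair of points can be joined by a rectifiable arc in $G$ satisfying (1) (not necessarily (2)), $G$ is a $b$-John domain. $G$ is a locally $a$-John domain if all metric balls $\mathbb{B}(x,r)$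 of the ambient space with $x\in G$ and $0<r\le\delta_G(x)$ are $a$-John domains. $G$ is non-point-cut if for every $x\in G$ the set $G\setminus\{x\}$ is a subdomain of $G$. The quasihyperbolic distance in $G\subsetneq X$ is $k_G(x,y)=\inf_\gamma\int_\gamma\frac{|dz|}{\delta_G(z)}$, the infimum over all rectifiable arcs $\gamma$ in $G$ joining $x$ to $y$. A homeomorphism $f:G\to G'$ between domains $G\subsetneq X$, $G'\subsetneq Y$ is $M$-quasihyperbolic ($M$-QH) if $\frac1M k_G(x,y)\le k_{G'}(f(x),f(y))\le M k_G(x,y)$ for all $x,y\in G$. *)

(* Defs.v *)
From mathcomp Require Export all_boot all_order all_algebra.
From mathcomp Require Export all_classical all_reals all_analysis.

Set Implicit Arguments.
Unset Strict Implicit.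
Unset Printing Implicit Defensive.

Import Order.TTheory GRing.Theory Num.Theory.
Import numFieldNormedType.Exports.

Local Open Scope classical_set_scope.
Local Open Scope ring_scope.

Definition complete_space (T : uniformType) : Prop :=
  forall F : set_system T, ProperFilter F -> cauchy F -> exists x : T, F --> x.

Definition domain (T : topologicalType) (G : set T) : Prop :=
  [/\ G !=set0, open G & connected G].

Definition boundary (T : topologicalType) (G : set T) : set T :=
  closure G `\` interior G.

(* Meaningful only when the boundary is nonempty: inf set0 = 0. *)
Definition bdist (R : realType) (X : metricType R) (G : set X) (z : X) : R :=
  inf [set mdist z w | w in boundary G].

(* An arc is an injective path on some [0, T] with T >= 0.  T = 0 gives a
   one-point arc, so that a point is joined to itself by an arc of length 0. *)
Definition arc_in (R : realType) (X : metricType R) (A : set X) (x y : X)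
    (T : R) (g : R -> X) : Prop :=
  [/\ 0 <= T, {within `[0, T], continuous g}, set_inj `[0, T] g,
      g 0 = x /\ g T = y & g @` `[0, T] `<=` A].

Definition chord_sum (R : realType) (X : metricType R) (g : R -> X) (a b : R)
    (s : seq R) : R :=
  \sum_(0 <= i < size s) mdist (g (nth b (a :: s) i)) (g (nth b (a :: s) i.+1)).

(* The same partitions as in total_variation, for a metric-valued path. *)
Definition path_length (R : realType) (X : metricType R) (g : R -> X)
    (a b : R) : \bar R :=
  ereal_sup [set (chord_sum g a b s)%:E | s in [set s | itv_partition a b s]].

Definition rectifiable (R : realType) (X : metricType R) (T : R)
    (g : R -> X) : Prop :=
  (path_length g 0 T < +oo)%E.

(* g (t) for the parameter t at which the arc has run through length u; t is
   unique for 0 <= u <= length of a rectifiable arc. *)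
Definition arclength_param (R : realType) (X : metricType R) (T : R)
    (g : R -> X) (u : R) : X :=
  g (xget 0 [set t | t \in `[0, T] /\ path_length g 0 t = u%:E]).

(* \int_g rho |dz|, for a rectifiable arc g on [0, T] *)
Definition line_integral (R : realType) (X : metricType R) (rho : X -> R)
    (T : R) (g : R -> X) : \bar R :=
  (\int[lebesgue_measure]_(u in `[0%R, fine (path_length g 0 T)])
     (rho (arclength_param T g u))%:E)%E.

Definition quasiconvex (R : realType) (c : R) (X : metricType R) : Prop :=
  1 <= c /\
  forall x y : X, exists (T : R) (g : R -> X),
    arc_in setT x y T g /\ (path_length g 0 T <= (c * mdist x y)%:E)%E.

(* min (l(g[x,z]), l(g[z,y])) <= b delta_G(z) for all z on g *)
Definition cigar (R : realType) (X : metricType R) (b : R) (G : set X)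
    (T : R) (g : R -> X) : Prop :=
  forall t : R, t \in `[0, T] ->
    (Order.min (path_length g 0 t) (path_length g t T)
       <= (b * bdist G (g t))%:E)%E.

Definition john_domain (R : realType) (X : metricType R) (b : R)
    (G : set X) : Prop :=
  [/\ domain G, G <> setT &
      forall x y, G x -> G y -> exists (T : R) (g : R -> X),
        [/\ arc_in G x y T g, rectifiable T g & cigar b G T g]].

Definition uniform_domain (R : realType) (X : metricType R) (b : R)
    (G : set X) : Prop :=
  [/\ domain G, G <> setT &
      forall x y, G x -> G y -> exists (T : R) (g : R -> X),
        [/\ arc_in G x y T g, rectifiable T g, cigar b G T g &
            (path_length g 0 T <= (b * mdist x y)%:E)%E]].

Definition locally_john (R : realType) (X : metricType R) (a : R)
    (G : set X) : Prop :=
  forall (x : X) (r : R), G x -> 0 < r -> r <= bdist G x ->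
    john_domain a (ball x r).

Definition non_point_cut (T : topologicalType) (G : set T) : Prop :=
  forall x, G x -> domain (G `\ x).

Definition qh_dist (R : realType) (X : metricType R) (G : set X)
    (x y : X) : \bar R :=
  ereal_inf [set l | exists (T : R) (g : R -> X),
    [/\ arc_in G x y T g, rectifiable T g &
        l = line_integral (fun z => (bdist G z)^-1) T g]].

Definition homeomorphism_on (S T : topologicalType) (A : set S) (B : set T)
    (f : S -> T) : Prop :=
  exists g : T -> S,
    [/\ f @` A `<=` B, g @` B `<=` A, {in A, cancel f g}, {in B, cancel g f} &
        {within A, continuous f} /\ {within B, continuous g}].

Definition quasihyperbolic (R : realType) (X Y : metricType R) (M : R)
    (G : set X) (G' : set Y) (f : X -> Y) : Prop :=
  homeomorphism_on G G' f /\
  forall x y, G x -> G y ->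
    ((M^-1)%:E * qh_dist G x y <= qh_dist G' (f x) (f y) /\
     qh_dist G' (f x) (f y) <= M%:E * qh_dist G x y)%E.

(* Main.v *)
(* An eta-chain in U is a sequence of points with successive distances at most
   eta times the distance d to the boundary of U.  Points x, y of a uniform
   domain U are joined by an eta-chain whose length is at most
   A log ((1 + |x-y|/d(x)) (1 + |x-y|/d(y))) + B.  At small scale f and its
   inverse g are Lipschitz relative to the boundary distances of G and G', which
   gives three things for D' = f(D):
   - d_D'(f x) / d_G'(f x) is comparable to d_D(x) / d_G(x);
   - f maps a chain of D to a chain of D';
   - g maps a chain of the uniform domain G' to a chain of G, so that
     |x-y| / d_G(x) is at most a power of the product
     (1 + |x'-y'|/d_G'(x')) (1 + |x'-y'|/d_G'(y')), where x' = f x, y' = f y;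
     by the first point this persists with D, D' in place of G, G'.
   Hence points x', y' of D' are joined by a chain of D' of length
   O(log (1 + |x'-y'| / min (d(x'), d(y'))) + 1).  A shortest such chain is a
   discrete quasihyperbolic geodesic, and, as in the theorem of Gehring and
   Osgood, the boundary distance along it first rises and then falls at a
   geometric rate.  Filling its steps with short arcs gives a uniform arc.
   The logarithmic bounds are written as q ^ n <= C * (1 + ...) ^ p with q > 1. *)

Require Import Defs.
From mathcomp Require Import zify ring lra.

Set Implicit Arguments.
Unset Strict Implicit.
Unset Printing Implicit Defensive.

Import Order.TTheory GRing.Theory Num.Theory.
Import numFieldNormedType.Exports.
Local Open Scope classical_set_scope.
Local Open Scope ring_scope.

(** * Length of paths and distance to the boundary *)

Lemma chord_sum_nil (R : realType) (X : metricType R) (g : R -> X) (a b : R) :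
  chord_sum g a b [::] = 0.
Proof. by rewrite /chord_sum big_nil. Qed.

Lemma chord_sum_cons (R : realType) (X : metricType R) (g : R -> X)
    (a b c : R) (s : seq R) :
  chord_sum g a b (c :: s) = mdist (g a) (g c) + chord_sum g c b s.
Proof. by rewrite /chord_sum big_nat_recl. Qed.

Lemma chord_sum_rcons (R : realType) (X : metricType R) (g : R -> X)
    (a b c : R) (s : seq R) : last a s = b ->
  chord_sum g a c (rcons s c) = chord_sum g a b s + mdist (g b) (g c).
Proof.
elim: s a => [|x s IH] a /= E.
  by rewrite E chord_sum_cons !chord_sum_nil addr0 add0r.
by rewrite !chord_sum_cons IH// addrA.
Qed.

Lemma path_length_ge0 (R : realType) (X : metricType R) (g : R -> X) (a b : R) :
  a <= b -> (0 <= path_length g a b)%E.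
Proof.
rewrite le_eqVlt => /orP[/eqP ->|ab].
  apply: ereal_sup_ubound; exists [::]; last by rewrite chord_sum_nil.
  by split=> //=.
apply: (@le_trans _ _ (mdist (g a) (g b))%:E).
  by rewrite lee_fin mdist_ge0.
apply: ereal_sup_ubound; exists [:: b]; first exact: itv_partition1.
by rewrite chord_sum_cons chord_sum_nil addr0.
Qed.

Lemma path_length_rcons (R : realType) (X : metricType R) (g : R -> X)
    (a b c : R) : a <= b -> b <= c ->
  (path_length g a b + (mdist (g b) (g c))%:E <= path_length g a c)%E.
Proof.
move=> ab; rewrite le_eqVlt => /orP[/eqP ->|bc].
  by rewrite mdistxx adde0.
rewrite -leeBrDr//; apply: ge_ereal_sup => _ [s ps <-].
rewrite leeBrDr//; apply: ereal_sup_ubound; exists (rcons s c).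
  by rewrite -cats1; apply: itv_partition_cat ps _; apply: itv_partition1.
by case: ps => _ /eqP E; rewrite (chord_sum_rcons _ _ E).
Qed.

Lemma path_length_cons (R : realType) (X : metricType R) (g : R -> X)
    (a b c : R) : a <= b -> b <= c ->
  ((mdist (g a) (g b))%:E + path_length g b c <= path_length g a c)%E.
Proof.
rewrite le_eqVlt => /orP[/eqP ->|ab] bc.
  by rewrite mdistxx add0e.
rewrite -leeBrDl//; apply: ge_ereal_sup => _ [s ps <-].
rewrite leeBrDl//; apply: ereal_sup_ubound; exists (b :: s).
  by rewrite -cat1s; apply: itv_partition_cat ps; apply: itv_partition1.
by rewrite chord_sum_cons.
Qed.

Lemma path_length_xx (R : realType) (X : metricType R) (g : R -> X) (a : R) :
  path_length g a a = 0%E.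
Proof.
apply/eqP; rewrite eq_le path_length_ge0// andbT.
apply: ge_ereal_sup => _ [s /itv_partitionxx -> <-].
by rewrite chord_sum_nil.
Qed.

(** Every chord sum is dominated by a telescoping sum of increments of phi. *)
Lemma path_length_le (R : realType) (X : metricType R) (g : R -> X)
    (phi : R -> R) (a b : R) :
  (forall s t, a <= s -> s <= t -> t <= b ->
    mdist (g s) (g t) <= phi t - phi s) ->
  (path_length g a b <= (phi b - phi a)%:E)%E.
Proof.
move=> H; apply: ge_ereal_sup => _ [s ps <-]; rewrite lee_fin.
elim: s a H ps => [|c s IH] a H ps.
  by rewrite (itv_partition_nil ps) chord_sum_nil subrr.
rewrite chord_sum_cons.
have [+ _] := ps; rewrite /= => /andP[ac _].
have cb := itv_partition_le (itv_partition_cons ps).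
have h1 := H a c (lexx _) (ltW ac) cb.
have := IH c _ (itv_partition_cons ps).
have h2 : forall s t, c <= s -> s <= t -> t <= b -> mdist (g s) (g t) <= phi t - phi s.
  by move=> u v cu; apply: H; apply: (le_trans (ltW ac)).
move/(_ h2); lra.
Qed.

Lemma mdist_le_path_length (R : realType) (X : metricType R) (g : R -> X)
    (a b : R) : a <= b -> ((mdist (g a) (g b))%:E <= path_length g a b)%E.
Proof.
move=> ab; have := path_length_rcons g (lexx a) ab.
by rewrite path_length_xx add0e.
Qed.

Lemma path_length_leL (R : realType) (X : metricType R) (g : R -> X)
    (a b c : R) : a <= b -> b <= c ->
  (path_length g a b <= path_length g a c)%E.
Proof.
move=> ab bc; apply: le_trans (path_length_rcons g ab bc).
by rewrite leeDl// lee_fin mdist_ge0.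
Qed.

Lemma path_length_leR (R : realType) (X : metricType R) (g : R -> X)
    (a b c : R) : a <= b -> b <= c ->
  (path_length g b c <= path_length g a c)%E.
Proof.
move=> ab bc; apply: le_trans (path_length_cons g ab bc).
by rewrite leeDr// lee_fin mdist_ge0.
Qed.

Lemma bdist_ge0 (R : realType) (X : metricType R) (U : set X) (x : X) :
  0 <= bdist U x.
Proof.
rewrite /bdist; have [/set0P E|] := boolP ([set mdist x w | w in boundary U] != set0).
  by apply: lb_le_inf => // _ [w _ <-]; apply: mdist_ge0.
by rewrite negbK => /eqP ->; rewrite inf0.
Qed.

Lemma bdist_le (R : realType) (X : metricType R) (U : set X) (x w : X) :
  boundary U w -> bdist U x <= mdist x w.
Proof.
move=> Uw; apply: ge_inf; last by exists w.
by exists 0 => _ [v _ <-]; apply: mdist_ge0.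
Qed.

Lemma le_bdist (R : realType) (X : metricType R) (U : set X) (x : X) (r : R) :
  boundary U !=set0 -> (forall w, boundary U w -> r <= mdist x w) ->
  r <= bdist U x.
Proof.
move=> [v Uv] H; apply: lb_le_inf; first by exists (mdist x v); exists v.
by move=> _ [w Uw <-]; apply: H.
Qed.

Lemma bdist_lip (R : realType) (X : metricType R) (U : set X) (x y : X) :
  bdist U x <= bdist U y + mdist x y.
Proof.
have [B|] := boolP (boundary U != set0); last first.
  rewrite negbK => /eqP E.
  by rewrite {1}/bdist E image_set0 inf0 addr_ge0 ?bdist_ge0 ?mdist_ge0.
rewrite -lerBlDr; apply: le_bdist; first exact/set0P.
move=> w Uw; rewrite lerBlDr addrC.
by apply: le_trans (bdist_le _ Uw) (metric_triangle _ _ _).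
Qed.

Lemma open_mdist (R : realType) (X : metricType R) (U : set X) (x : X) :
  open U -> U x -> exists2 e : R, 0 < e & forall y, mdist x y < e -> U y.
Proof.
move=> /[swap] Ux; rewrite openE => /(_ _ Ux).
rewrite /interior/= -filter_from_ballE => -[e e0 H]; exists e => // y xy.
by apply: H; rewrite ballEmdist.
Qed.

Lemma boundary_open (R : realType) (X : metricType R) (U : set X) (w : X) :
  open U -> boundary U w -> ~ U w.
Proof. by move=> oU [_ +] Uw; rewrite (interior_id _).1 //. Qed.

Lemma bdist_gt0 (R : realType) (X : metricType R) (U : set X) (x : X) :
  open U -> boundary U !=set0 -> U x -> 0 < bdist U x.
Proof.
move=> oU B Ux; have [e e0 H] := open_mdist oU Ux.
apply: (lt_le_trans e0); apply: le_bdist => // w /(boundary_open oU) nUw.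
by rewrite leNgt; apply/negP => /H.
Qed.

(** If g missed the boundary of U on [0, t], the part of its image lying in U would be nonempty,
    relatively open and relatively closed, hence the whole image, by connectedness. *)
Lemma path_boundary (R : realType) (X : metricType R) (U : set X) (T t : R)
    (g : R -> X) : open U -> {within `[0, T], continuous g} -> 0 <= t -> t <= T ->
  U (g 0) -> ~ U (g t) -> exists2 s, 0 <= s <= t & boundary U (g s).
Proof.
move=> oU cg t0 tT U0 Ut.
have cA : connected (g @` `[0, t]).
  apply: connected_continuous_connected; first exact: segment_connected.
  apply: continuous_subspaceW cg => u /=; rewrite !in_itv/= => /andP[-> /le_trans].
  exact.
apply: contrapT => nB.
suff E : (g @` `[0, t]) `&` U = g @` `[0, t].
  suff : ((g @` `[0, t]) `&` U) (g t) by case.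
  by rewrite E; exists t => //=; rewrite in_itv/= t0 lexx.
apply: cA.
- by exists (g 0); split=> //; exists 0 => //=; rewrite in_itv/= lexx t0.
- by exists U.
- exists (closure U); first exact: closed_closure.
  rewrite eqEsubset; split=> [x [xA Ux]|x [xA Ux]]; split=> //.
    exact: subset_closure.
  apply: contrapT => nUx; apply: nB; case: xA => s /=; rewrite in_itv/= => st E.
  exists s => //; rewrite E; split=> //.
  by rewrite (interior_id _).1.
Qed.

(** The integral of a nonnegative function is a supremum over the simple functions below it, hence
    monotone for arbitrary integrands. It is used for [line_integral], whose integrand is not shown
    to be measurable. *)
Lemma ge0_le_integral_nonmeas d (T : measurableType d) (R : realType)
    (mu : {measure set T -> \bar R}) (D : set T) (f1 f2 : T -> \bar R) :
  (forall x, D x -> (0 <= f1 x)%E) -> (forall x, D x -> (f1 x <= f2 x)%E) ->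
  (\int[mu]_(x in D) f1 x <= \int[mu]_(x in D) f2 x)%E.
Proof.
move=> f10 f12.
have f20 x : D x -> (0 <= f2 x)%E by move=> Dx; apply: le_trans (f12 _ Dx); apply: f10.
rewrite !ge0_integralE//; apply: le_ereal_sup => _ [h /= hf <-]; exists h => //= x.
apply: le_trans (hf x) _; rewrite /patch; case: ifPn => // xD.
by apply: f12; rewrite inE in xD.
Qed.

Lemma integral_cst_itv0 (R : realType) (k L : R) : 0 <= L ->
  (\int[lebesgue_measure]_(u in `[0%R, L]) k%:E = (k * L)%:E)%E.
Proof.
move=> L0; rewrite (integral_cst _ _ k%:E)//=.
have -> : lebesgue_measure [set` `[0, L]] = L%:E.
  rewrite lebesgue_measure_itv/= lte_fin -EFinD subr0.
  by case: ltP => // L0'; congr _%:E; apply/eqP; rewrite eq_le L0 L0'.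
by rewrite EFinM.
Qed.

(** A path that leaves U meets the boundary first, and so has length at least the boundary distance
    of its starting point. *)
Lemma path_subset (R : realType) (X : metricType R) (U : set X) (T L : R)
    (g : R -> X) : open U -> {within `[0, T], continuous g} ->
  (path_length g 0 T <= L%:E)%E -> U (g 0) -> L < bdist U (g 0) ->
  g @` `[0, T] `<=` U.
Proof.
move=> oU cg gL U0 Ld _ [t + <-]; rewrite /= in_itv/= => /andP[t0 tT].
apply: contrapT => nUt.
have [s /andP[s0 st] /(bdist_le (g 0)) B] := path_boundary oU cg t0 tT U0 nUt.
have : ((mdist (g 0) (g s))%:E <= L%:E)%E.
  apply: le_trans (mdist_le_path_length _ s0) _.
  by apply: le_trans gL; apply: path_length_leL => //; apply: le_trans tT.
rewrite lee_fin; lra.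
Qed.

(** A quasiconvex arc from x to w shorter than the boundary distance of x would stay in U. Thus the
    distances to the boundary and to the complement are comparable. *)
Lemma quasiconvex_bdist (R : realType) (c : R) (X : metricType R) (U : set X)
    (x w : X) : quasiconvex c X -> open U -> U x -> ~ U w ->
  bdist U x <= c * mdist x w.
Proof.
move=> [c1 qc] oU Ux nUw; rewrite leNgt; apply/negP => lt.
have [T [g [[T0 cg _ [g0 gT] _] gL]]] := qc x w.
apply: nUw; rewrite -gT; rewrite -g0 in lt Ux gL.
apply: (path_subset oU cg gL Ux lt); exists T => //=.
by rewrite in_itv/= lexx T0.
Qed.

Lemma quasiconvex_boundary (R : realType) (c : R) (X : metricType R)
    (U : set X) : quasiconvex c X -> domain U -> U <> setT ->
  boundary U !=set0.
Proof.
move=> [c1 qc] [[x Ux] oU _] UT.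
have [w nUw] : exists w, ~ U w.
  apply: contrapT => /forallNP H; apply: UT; apply/seteqP; split=> // y _.
  by apply: contrapT; exact: H.
have [T [g [[T0 cg _ [g0 gT] _] gL]]] := qc x w.
rewrite -g0 in Ux; rewrite -gT in nUw.
by have [s _ B] := path_boundary oU cg T0 (lexx _) Ux nUw; exists (g s).
Qed.

(** * Quasihyperbolic distance at small scale *)

Lemma arclength_paramP (R : realType) (X : metricType R) (T : R) (g : R -> X)
    (u : R) : 0 <= T -> 0 <= u -> exists t,
  [/\ 0 <= t <= T, arclength_param T g u = g t & (path_length g 0 t <= u%:E)%E].
Proof.
move=> T0 u0; rewrite /arclength_param.
set S := [set t | _]; have [[t St]|nS] := pselect (S !=set0).
  have [/= tT E] : S (xget 0 S) by apply: (xgetI _ St).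
  by exists (xget 0 S); split=> //; rewrite ?E// -in_itv.
(* If no parameter has length exactly u, [xget] returns its default 0, which satisfies the same
   bounds. *)
rewrite xgetPN; last by move=> t St; apply: nS; exists t.
by exists 0; rewrite lexx T0 path_length_xx lee_fin.
Qed.

Lemma mdist_arclength_param (R : realType) (X : metricType R) (T : R)
    (g : R -> X) (u : R) : 0 <= T -> 0 <= u ->
  mdist (g 0) (arclength_param T g u) <= u.
Proof.
move=> T0 u0; have [t [/andP[t0 tT] -> H]] := arclength_paramP g T0 u0.
by rewrite -lee_fin; apply: le_trans H; apply: mdist_le_path_length.
Qed.

(** A quasiconvex arc from x to y has length at most half the boundary distance of x, so the
    integrand along it is at most twice its value at x. *)
Lemma qh_dist_le (R : realType) (c : R) (X : metricType R) (U : set X)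
    (x y : X) : quasiconvex c X -> open U -> U x -> 0 < bdist U x ->
  2 * c * mdist x y <= bdist U x ->
  (qh_dist U x y <= (2 * c * mdist x y / bdist U x)%:E)%E.
Proof.
move=> [c1 qc] oU Ux dx xy.
have [T [g [[T0 cg gi [g0 gT] _] gL]]] := qc x y.
have cxy : 0 <= c * mdist x y by rewrite mulr_ge0 ?mdist_ge0 //; lra.
have cxyd : c * mdist x y < bdist U x by nra.
have gU : g @` `[0, T] `<=` U.
  by apply: (path_subset oU cg gL); rewrite g0.
have lg0 := path_length_ge0 g T0.
have lfin : (path_length g 0 T \is a fin_num).
  by rewrite ge0_fin_numE//; apply: le_lt_trans gL _; rewrite ltry.
apply: (@le_trans _ _ (line_integral (fun z => (bdist U z)^-1) T g)).
  apply: ereal_inf_lbound; exists T, g; split=> //; rewrite /rectifiable.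
  by apply: le_lt_trans gL _; rewrite ltry.
rewrite /line_integral; set L := fine _.
have L0 : 0 <= L by rewrite fine_ge0.
have Lc : L <= c * mdist x y by rewrite -lee_fin fineK.
apply: (@le_trans _ _ (\int[lebesgue_measure]_(u in `[0%R, L]) (2 / bdist U x)%:E)%E).
  apply: ge0_le_integral_nonmeas => u /=; rewrite in_itv/= => /andP[u0 uL].
    by rewrite lee_fin invr_ge0 bdist_ge0.
  have := mdist_arclength_param g T0 u0; rewrite g0 => H.
  have := bdist_lip U x (arclength_param T g u) => H2.
  have H3 : bdist U x / 2 <= bdist U (arclength_param T g u) by nra.
  have H4 : 0 < bdist U x / 2 by lra.
  by rewrite lee_fin -[2 / _]invf_div lef_pV2 ?posrE//; lra.
rewrite integral_cst_itv0// lee_fin mulrAC ler_pM2r ?invr_gt0//; lra.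
Qed.

(** On the initial piece of an arc, of length min (L, d(x)), the boundary distance is at most 2
    d(x). The value 1/2 of the minimum accounts for arcs longer than d(x). *)
Lemma le_qh_dist (R : realType) (X : metricType R) (U : set X)
    (x y : X) : open U -> boundary U !=set0 -> U x ->
  ((Order.min 2^-1 (mdist x y / (2 * bdist U x)))%:E <= qh_dist U x y)%E.
Proof.
move=> oU BU Ux; have dx := bdist_gt0 oU BU Ux.
apply: le_ereal_inf_tmp => _ [T [g [[T0 cg gi [g0 gT] gU] rg ->]]].
rewrite /line_integral; set L := fine _.
have lfin : (path_length g 0 T \is a fin_num).
  by rewrite ge0_fin_numE//; apply: path_length_ge0.
have L0 : 0 <= L by rewrite fine_ge0 ?path_length_ge0.
have xyL : mdist x y <= L.
  rewrite -lee_fin fineK// -g0 -gT; exact: mdist_le_path_length.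
set m := Order.min L (bdist U x).
have m0 : 0 <= m by rewrite le_min L0 ltW.
apply: (@le_trans _ _ (\int[lebesgue_measure]_(u in `[0%R, m]) ((2 * bdist U x)^-1)%:E)%E).
  rewrite integral_cst_itv0// lee_fin /m; case: (leP L (bdist U x)) => h.
    rewrite ge_min; apply/orP; right; rewrite mulrC ler_pM2l// invr_gt0; lra.
  by rewrite invfM -mulrA mulVf ?gt_eqF// mulr1 ge_min lexx.
(* Both integrals are extended by zero to the whole line, so that the integrands on [[0, m]] and
   [[0, L]] can be compared pointwise. *)
rewrite integral_mkcond [leRHS]integral_mkcond.
apply: ge0_le_integral_nonmeas => u _; rewrite !patchE.
  case: ifP => // _; rewrite lee_fin invr_ge0; lra.
have E0 v : (0 <= ((bdist U v)^-1)%:E)%E by rewrite lee_fin invr_ge0 bdist_ge0.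
case: ifPn => [|_]; last by case: ifP.
rewrite inE/= in_itv/= => /andP[u0 um].
move: um; rewrite /m le_min => /andP[uL ud].
rewrite ifT; last by rewrite inE/= in_itv/= u0.
have := mdist_arclength_param g T0 u0; rewrite g0 metric_sym => H.
have := bdist_lip U (arclength_param T g u) x => H2.
have [t [tT E _]] := arclength_paramP g T0 u0.
have d0 : 0 < bdist U (arclength_param T g u).
  by rewrite E; apply: bdist_gt0 => //; apply: gU; exists t => //=; rewrite in_itv.
by rewrite lee_fin lef_pV2 ?posrE//; lra.
Qed.

(** * Chains *)

Definition chain (T : Type) (E : T -> T -> Prop) (n : nat) (x y : T) : Prop :=
  exists z : nat -> T,
    [/\ z 0 = x, z n = y & forall i, (i < n)%N -> E (z i) (z i.+1)].

Lemma chain0 (T : Type) (E : T -> T -> Prop) (x : T) : chain E 0 x x.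
Proof. by exists (fun=> x). Qed.

Lemma chain1 (T : Type) (E : T -> T -> Prop) (x y : T) : E x y -> chain E 1 x y.
Proof. by move=> xy; exists (fun i => if i is 0 then x else y); split=> // -[]. Qed.

Lemma chain_cat (T : Type) (E : T -> T -> Prop) (m n : nat) (x y z : T) :
  chain E m x y -> chain E n y z -> chain E (m + n) x z.
Proof.
move=> [u [u0 um uE]] [v [v0 vn vE]].
exists (fun i => if (i <= m)%N then u i else v (i - m)%N); split=> //.
- case: ifP => [|_]; last by rewrite addKn.
  by rewrite -{2}(addn0 m) leq_add2l leqn0 => /eqP E0; rewrite E0 addn0 um -vn E0.
- move=> i imn; case: ltngtP => [im|mi|E0].
  + exact: uE.
  + rewrite subSn; last exact: ltnW.
    by apply: vE; rewrite ltn_subLR// ltnW.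
  + rewrite E0 subSnn um -v0; apply: vE.
    by rewrite -(ltn_add2l m) addn0 -{1}E0.
Qed.

Lemma chain_map (S T : Type) (E : S -> S -> Prop) (E' : T -> T -> Prop)
    (f : S -> T) (n : nat) (x y : S) :
  (forall u v, E u v -> E' (f u) (f v)) -> chain E n x y ->
  chain E' n (f x) (f y).
Proof.
move=> H [z [z0 zn zE]]; exists (f \o z); split=> /=; rewrite ?z0 ?zn//.
by move=> i /zE /H.
Qed.

Lemma chain_sym (T : Type) (E : T -> T -> Prop) (n : nat) (x y : T) :
  (forall u v, E u v -> E v u) -> chain E n x y -> chain E n y x.
Proof.
move=> H [z [z0 zn zE]]; exists (fun i => z (n - i)%N); split.
- by rewrite subn0.
- by rewrite subnn.
- by move=> i iltn; apply: H; rewrite -[(n - i)%N](@subnSK i)//; apply: zE; rewrite subnSK// leq_subr.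
Qed.

Definition step (R : realType) (X : metricType R) (U : set X) (eta : R)
    (x y : X) : Prop :=
  [/\ U x, U y, mdist x y <= eta * bdist U x & mdist x y <= eta * bdist U y].

Lemma step_sym (R : realType) (X : metricType R) (U : set X) (eta : R)
    (x y : X) : step U eta x y -> step U eta y x.
Proof. by move=> [Ux Uy xy yx]; split=> //; rewrite metric_sym. Qed.

(** A bound at one end point suffices at half the ratio, because the boundary distance at y is then
    at least half that at x. *)
Lemma step_half (R : realType) (X : metricType R) (U : set X) (eta : R)
    (x y : X) : 0 <= eta -> eta <= 1 -> U x -> U y ->
  mdist x y <= eta / 2 * bdist U x -> step U eta x y.
Proof.
move=> e0 e1 Ux Uy xy; have dx := bdist_ge0 U x; split=> //; first nra.
have dy := bdist_lip U x y; apply: (le_trans xy).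
have h : bdist U x / 2 <= bdist U y.
  have : eta / 2 * bdist U x <= bdist U x / 2 by nra.
  lra.
nra.
Qed.

Lemma bernoulli_le (R : realType) (e : R) (n : nat) : 0 <= e ->
  1 + n%:R * e <= (1 + e) ^+ n.
Proof.
move=> e0; elim: n => [|n IH]; first by rewrite mul0r addr0 expr0.
have n0 : 0 <= n%:R * e by rewrite mulr_ge0.
rewrite exprS -natr1; nra.
Qed.

Lemma mdist_continuous (R : realType) (X : metricType R) (p : X) :
  continuous (mdist p : X -> R).
Proof.
move=> x; apply/cvgrPdist_lt => e e0.
near=> y; have xy : mdist x y < e.
  by near: y; apply: metricType_numDomainType.cvgr_dist_lt e0; exact: cvg_id.
have h1 := metric_triangle p x y; have h2 := metric_triangle p y x.
have h3 := metric_sym x y.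
by rewrite ltr_norml; apply/andP; split; lra.
Unshelve. all: by end_near. Qed.

(** With sigma the length run through and d the initial boundary distance, one walks by steps of
    size e (sigma t + d). The cigar bound makes these admissible, and sigma t + d grows by the
    factor 1 + e at each of them, so their number is logarithmic. *)
Lemma walk (R : realType) (X : metricType R) (U : set X) (b eta L tau : R)
    (g : R -> X) (sigma : R -> R) :
  0 < eta -> eta <= 1 -> 0 <= b -> 0 <= tau ->
  {within `[0, tau], continuous g} ->
  (forall t, 0 <= t <= tau -> U (g t)) -> 0 < bdist U (g 0) ->
  sigma 0 = 0 ->
  (forall s t, 0 <= s -> s <= t -> t <= tau ->
    mdist (g s) (g t) <= sigma t - sigma s) ->
  (forall t, 0 <= t -> t < tau -> sigma t <= b * bdist U (g t)) ->
  sigma tau <= L ->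
  exists n z, [/\ chain (step U eta) n (g 0) z, step U eta z (g tau) &
    (1 + eta / (2 * (1 + 2 * b))) ^+ n * bdist U (g 0) <= L + bdist U (g 0)].
Proof.
move=> eta0 eta1 b0 tau0 cg gU d0 s0 sg cig sL.
set e := eta / _; set d := bdist U (g 0).
have b1 : 0 < 1 + 2 * b by lra.
have e0 : 0 < e by rewrite divr_gt0//; lra.
have eE : e * (1 + 2 * b) = eta / 2.
  by rewrite /e invfM mulrA -mulrA mulVf ?mulr1// gt_eqF.
have smono s t : 0 <= s -> s <= t -> t <= tau -> sigma s <= sigma t.
  move=> s00 st tt; have := sg s t s00 st tt.
  have := mdist_ge0 (g s) (g t); lra.
have L0 : 0 <= L by have := smono 0 tau (lexx _) tau0 (lexx _); lra.
move: (tau0); rewrite le_eqVlt => /orP[/eqP tauE|taupos].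
  exists 0%N, (g 0); rewrite -tauE expr0 mul1r; split.
  - exact: chain0.
  - by split; rewrite ?mdistxx ?mulr_ge0 ?bdist_ge0 ?(ltW eta0)//; apply: gU; rewrite lexx.
  - by rewrite lerDr.
(* The number of steps that can be made before tau is bounded, since sigma is at most L. A maximal
   one is chosen. *)
pose P n := `[< exists t, [/\ 0 <= t < tau, chain (step U eta) n (g 0) (g t) &
   (1 + e) ^+ n * d <= sigma t + d] >].
have P0 : exists n, P n.
  exists 0%N; apply/asboolP; exists 0; rewrite lexx taupos expr0 mul1r s0 add0r.
  by split=> //; exact: chain0.
have PN n : P n -> (n <= Num.bound (L / (e * d)))%N.
  move=> /asboolP[t [/andP[t0 tt] _ H]].
  have h1 := smono t tau t0 (ltW tt) (lexx _).
  have h2 := bernoulli_le n (ltW e0).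
  have ed : 0 < e * d by rewrite mulr_gt0.
  have h3 : n%:R <= L / (e * d) by rewrite ler_pdivlMr//; nra.
  rewrite -(ler_nat R); apply: le_trans h3 _; apply: ltW.
  by apply: archi_boundP; rewrite divr_ge0// ltW.
case: (ex_maxnP P0 PN) => n /asboolP[t [/andP[t0 tt] ch H]] nmax.
have Ut : U (g t) by apply: gU; rewrite t0 ltW.
(* Here d is at most sigma t plus the boundary distance at [g t], and sigma t is at most b times the
   latter. *)
have dt : (1 + 2 * b) * bdist U (g t) >= sigma t + d.
  have h1 := cig t t0 tt; have h2 := sg 0 t (lexx _) t0 (ltW tt).
  have := bdist_lip U (g 0) (g t); rewrite -/d => h3; lra.
set rho := e * (sigma t + d).
have st0 : 0 <= sigma t by rewrite -s0; apply: smono => //; exact: ltW.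
have rho0 : 0 <= rho by rewrite mulr_ge0//; lra.
have rhod : rho <= eta / 2 * bdist U (g t).
  by rewrite /rho -eE -mulrA ler_pM2l.
exists n, (g t); split=> //; last first.
  by apply: le_trans H _; rewrite lerD2r; apply: (le_trans _ sL); apply: smono => //; exact: ltW.
apply: step_half => //; [exact: ltW|by apply: gU; rewrite tau0 lexx|].
(* If [g tau] were farther than rho from [g t], the intermediate value theorem would give a point at
   distance exactly rho, and one more step, against maximality. *)
apply: (le_trans _ rhod); rewrite leNgt; apply/negP => lt.
have [c + cE] : exists2 c, c \in `[t, tau] & mdist (g t) (g c) = rho.
  apply: (@IVT _ (fun c => mdist (g t) (g c))); first exact: ltW.
    move=> x; apply: (@continuous_comp (subspace `[t, tau]) X R g (mdist (g t))).
      apply: (continuous_subspaceW _ cg) => u /=; rewrite !in_itv/= => /andP[tu ->].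
      by rewrite andbT (le_trans t0).
    exact: mdist_continuous.
  by rewrite mdistxx ge_min rho0 le_max (ltW lt) orbT.
rewrite in_itv/= => /andP[tc ctau].
have ctau' : c < tau.
  by rewrite lt_neqAle ctau andbT; apply/eqP => E; move: lt; rewrite -E cE ltxx.
have : P n.+1.
  apply/asboolP; exists c; rewrite ctau' (le_trans t0 tc); split=> //.
    rewrite -addn1; apply: (chain_cat ch); apply: chain1.
    apply: step_half; rewrite ?cE //; first exact: ltW.
    by apply: gU; rewrite ctau (le_trans t0 tc).
  have := sg t c t0 tc ctau; rewrite cE /rho exprS -mulrA => h.
  have : (1 + e) * ((1 + e) ^+ n * d) <= (1 + e) * (sigma t + d).
    by rewrite ler_pM2l//; lra.
  lra.
by move/nmax; rewrite ltnn.
Qed.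

Lemma within_continuous_reparam (U V W : topologicalType) (A : set U)
    (B : set V) (h : U -> V) (f : V -> W) : continuous h ->
  (forall x, A x -> B (h x)) -> {within B, continuous f} ->
  {within A, continuous (f \o h)}.
Proof.
move=> ch AB /subspace_continuousP cf; apply/subspace_continuousP => x Ax.
apply: (@cvg_comp _ _ _ h f _ (within B (nbhs (h x)))); last exact/cf/AB.
move=> P nP; have nP' : nbhs x (fun y => B (h y) -> P (h y)) := ch x _ nP.
suff : nbhs x (fun y => A y -> P (h y)) by [].
by apply: filterS nP' => y hP Ay; exact/hP/AB.
Qed.

(** The arc is split near the middle of its length, and [walk] is applied from both ends. In each
    half the cigar condition bounds the length from the nearer end. *)
Lemma uniform_chain (R : realType) (X : metricType R) (U : set X)
    (b eta : R) (x y : X) :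
  0 < eta -> eta <= 1 -> 1 <= b -> boundary U !=set0 -> uniform_domain b U ->
  U x -> U y ->
  exists2 n, chain (step U eta) n x y &
    (1 + eta / (2 * (1 + 2 * b))) ^+ n <=
      4 * b ^+ 2 * (1 + mdist x y / bdist U x) * (1 + mdist x y / bdist U y).
Proof.
move=> eta0 eta1 b1 BU [[_ oU _] _ Uxy] Ux Uy.
have [T [g [[T0 cg gi [g0 gT] gU] rg cig gL]]] := Uxy x y Ux Uy.
have dx := bdist_gt0 oU BU Ux; have dy := bdist_gt0 oU BU Uy.
have xy0 := mdist_ge0 x y.
pose l s t := fine (path_length g s t).
have pf s t : 0 <= s -> s <= t -> t <= T -> path_length g s t = (l s t)%:E.
  move=> s0 st tT; rewrite fineK// ge0_fin_numE ?path_length_ge0//.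
  apply: le_lt_trans rg; apply: (@le_trans _ _ (path_length g 0 t)).
    exact: path_length_leR.
  by apply: path_length_leL => //; apply: le_trans st.
have l0 s : l s s = 0 by rewrite /l path_length_xx.
have lL s t u : 0 <= s -> s <= t -> t <= u -> u <= T ->
    l s t + mdist (g t) (g u) <= l s u.
  move=> s0 st tu uT; have := path_length_rcons g st tu.
  by rewrite !pf ?lee_fin// ?(le_trans tu)// (le_trans st).
have lR s t u : 0 <= s -> s <= t -> t <= u -> u <= T ->
    mdist (g s) (g t) + l t u <= l s u.
  move=> s0 st tu uT; have := path_length_cons g st tu.
  by rewrite !pf ?lee_fin// ?(le_trans st)// (le_trans s0).
have lmL s t u : 0 <= s -> s <= t -> t <= u -> u <= T -> l s t <= l s u.
  move=> s0 st tu uT; have := lL s t u s0 st tu uT.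
  have := mdist_ge0 (g t) (g u); lra.
have lmR s t u : 0 <= s -> s <= t -> t <= u -> u <= T -> l t u <= l s u.
  move=> s0 st tu uT; have := lR s t u s0 st tu uT.
  have := mdist_ge0 (g s) (g t); lra.
have lT : l 0 T <= b * mdist x y by rewrite -lee_fin -pf.
have gUt t : 0 <= t <= T -> U (g t).
  by move=> tT; apply: gU; exists t => //=; rewrite in_itv.
pose A := [set t | 0 <= t <= T /\ l 0 t <= l t T].
have A0 : A 0.
  by split; [rewrite lexx T0|rewrite l0 fine_ge0// path_length_ge0].
have AT t : A t -> t <= T by move=> [/andP[]].
have hA : has_sup A by split; [exists 0 | exists T].
set tau := sup A.
have tau0 : 0 <= tau by apply: (sup_upper_bound hA).
have tauT : tau <= T by apply: ge_sup; [exists 0 | exact: AT].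
have Alt t : 0 <= t -> t < tau -> l 0 t <= b * bdist U (g t).
  move=> t0 tt; have [s [/andP[s0 sT] sA] ts] := sup_gt hA.1 tt.
  have tT : t <= T by lra.
  have h : l 0 t <= l t T.
    apply: (le_trans (lmL 0 t s (lexx _) t0 (ltW ts) sT)).
    by apply: (le_trans sA); apply: lmR => //; exact: ltW.
  have := cig t; rewrite in_itv/= t0 tT => /(_ isT).
  by rewrite !pf// -EFin_min lee_fin ge_min => /orP[|]; lra.
have Agt t : tau < t -> t <= T -> l t T <= b * bdist U (g t).
  move=> tt tT; have t0 : 0 <= t by lra.
  have h : l t T <= l 0 t.
    rewrite leNgt; apply/negP => /ltW h.
    have At : A t by split=> //; rewrite t0.
    by have := sup_upper_bound hA At; rewrite -/tau leNgt tt.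
  have := cig t; rewrite in_itv/= t0 tT => /(_ isT).
  by rewrite !pf// -EFin_min lee_fin ge_min => /orP[|]; lra.
have Utau : U (g tau) by apply: gUt; rewrite tau0.
have b0 : 0 <= b by lra.
have l0T : l 0 tau <= b * mdist x y by apply: le_trans lT; apply: lmL.
have lTT : l tau T <= b * mdist x y by apply: le_trans lT; apply: lmR.
have [m [z [cz sz mz]]] : exists m z, [/\ chain (step U eta) m x z,
    step U eta z (g tau) &
    (1 + eta / (2 * (1 + 2 * b))) ^+ m * bdist U x <=
      b * mdist x y + bdist U x].
  rewrite -g0 in dx *.
  apply: (@walk _ _ _ _ _ _ _ _ (l 0)); rewrite -?g0//.
  - apply: continuous_subspaceW cg => u /=; rewrite !in_itv/= => /andP[-> /le_trans].
    exact.
  - by move=> t /andP[t0 tt]; apply: gUt; rewrite t0 (le_trans tt).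
  - move=> s t s0 st tt; have := lL 0 s t (lexx _) s0 st (le_trans tt tauT); lra.
  - by rewrite g0.
have [n [w [cw sw nw]]] : exists n w, [/\ chain (step U eta) n y w,
    step U eta w (g tau) &
    (1 + eta / (2 * (1 + 2 * b))) ^+ n * bdist U y <=
      b * mdist x y + bdist U y].
  (* The second walk follows the reversed arc, starting at y. *)
  have E0 : (g \o (fun t => T - t)) 0 = y by rewrite /= subr0.
  have E1 : (g \o (fun t => T - t)) (T - tau) = g tau by rewrite /= subKr.
  have := @walk _ X U b eta (b * mdist x y) (T - tau) (g \o (fun t => T - t))
    (fun t => l (T - t) T) eta0 eta1 b0.
  rewrite E0 E1; apply=> //.
  - by rewrite subr_ge0.
  - apply: within_continuous_reparam cg.
      by move=> t; apply: cvgB; [exact: cvg_cst | exact: cvg_id].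
    by move=> t /=; rewrite !in_itv/= => /andP[t0 tt]; apply/andP; split; lra.
  - by move=> t /andP[t0 tt]; apply: gUt; apply/andP; split; lra.
  - by rewrite subr0.
  - move=> s t s0 st tt; have := lR (T - t) (T - s) T.
    rewrite metric_sym /= => h; have := h _ _ _ (lexx _); lra.
  - move=> t t0 tt /=; apply: Agt; lra.
  - by rewrite subKr.
exists (m + (1 + (1 + n)))%N.
  apply: (chain_cat cz); apply: (chain_cat (chain1 sz)).
  apply: (chain_cat (chain1 (step_sym sw))).
  by apply: chain_sym cw => u v; apply: step_sym.
set e := eta / _ in mz nw *.
have e0 : 0 <= e by rewrite divr_ge0//; lra.
have e1 : e <= 1 by rewrite ler_pdivrMr; lra.
rewrite !exprD !expr1.
have Q z0 k : 0 < z0 -> (1 + e) ^+ k * z0 <= b * mdist x y + z0 ->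
    (1 + e) ^+ k <= b * (1 + mdist x y / z0).
  move=> z00; rewrite -ler_pdivlMr// => h; apply: (le_trans h).
  rewrite mulrDl divff ?gt_eqF// mulrDr mulr1 mulrA; lra.
have Qx := Q _ _ dx mz; have Qy := Q _ _ dy nw.
have p0 k : 0 <= (1 + e) ^+ k by rewrite exprn_ge0//; lra.
set u := 1 + mdist x y / bdist U x in Qx *; set v := 1 + mdist x y / bdist U y in Qy *.
(* Each of the two connecting steps at [g tau] contributes a factor 1 + e, which is at most 2. *)
have -> : 4 * b ^+ 2 * u * v = (b * u) * (2 * (2 * (b * v))) by ring.
move: (p0 m) (p0 n) Qx Qy; clearbody e u v; clear -e0 e1 => pm pn Qx Qy.
apply: ler_pM => //; first by rewrite !mulr_ge0//; lra.
apply: ler_pM; [lra|by rewrite !mulr_ge0//; lra|lra|].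
by apply: ler_pM => //; lra.
Qed.

(** * Boundary distances and chains under quasihyperbolic maps *)

(** Boundary points of G lie outside G, hence outside D, and [quasiconvex_bdist] applies to them. *)
Lemma bdist_subset (R : realType) (c : R) (X : metricType R) (D G : set X)
    (x : X) : quasiconvex c X -> open D -> open G -> boundary G !=set0 ->
  D `<=` G -> D x -> bdist D x <= c * bdist G x.
Proof.
move=> qc oD oG BG DG Dx; have [c1 _] := qc.
have c0 : 0 < c by lra.
rewrite -ler_pdivrMl//; apply: le_bdist => // w Gw; rewrite ler_pdivrMl//.
by apply: (quasiconvex_bdist qc oD Dx) => /DG; apply: boundary_open.
Qed.

(** The Lipschitz condition at small scale for distances normalised by the boundary distances,
    cleared of denominators. *)
Definition scaled_lip (R : realType) (X Y : metricType R) (lam : R) (G : set X)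
    (G' : set Y) (f : X -> Y) : Prop :=
  forall x y, G x -> G y -> 2 * lam * mdist x y <= bdist G x ->
    mdist (f x) (f y) * bdist G x <= lam * mdist x y * bdist G' (f x).

(* The data of Theorem 3 that is stable under exchanging [f] with its inverse;
   the theorem is used through [half_setting] for [f] and for its inverse. *)
Definition half_setting (R : realType) (X Y : metricType R) (c lam : R)
    (G D : set X) (G' D' : set Y) (f : X -> Y) : Prop :=
  [/\ [/\ quasiconvex c X, open G, open D, boundary G !=set0 & boundary D !=set0],
      D `<=` G, forall x, G x -> G' (f x),
      forall x, G x -> (D x <-> D' (f x)) & scaled_lip lam G G' f].

(** Let w be a boundary point of D. If w is close to x relative to G, then f w lies outside D' and
    the Lipschitz bound applies. Otherwise |x-w| is at least a fixed multiple of d_G(x), and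
    [bdist_subset] in Y suffices. *)
Lemma bdist_image (R : realType) (X Y : metricType R) (c lam : R)
    (G D : set X) (G' D' : set Y) (f : X -> Y) (x : X) :
  c <= lam -> half_setting c lam G D G' D' f ->
  quasiconvex c Y -> open G' -> open D' -> boundary G' !=set0 -> D' `<=` G' ->
  D x ->
  bdist D' (f x) * bdist G x <= 2 * c * lam * bdist D x * bdist G' (f x).
Proof.
move=> cl [[qX oG oD BG BD] DG fG fD flip] qY oG' oD' BG' DG' Dx.
have [c1 _] := qX; have Gx := DG _ Dx.
have D'x : D' (f x) by apply/fD.
have d'0 := bdist_gt0 oG' BG' (fG _ Gx).
have d0 := bdist_gt0 oG BG Gx.
have c0 : 0 < 2 * c * lam * bdist G' (f x).
  by rewrite mulr_gt0// mulr_gt0//; lra.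
rewrite mulrAC -ler_pdivrMl//; apply: le_bdist => // w Dw.
rewrite ler_pdivrMl//; have nDw := boundary_open oD Dw.
have xw0 := mdist_ge0 x w.
have [xw|xw] := leP (2 * lam * mdist x w) (bdist G x); last first.
  have h := bdist_subset qY oD' oG' BG' DG' D'x.
  apply: (@le_trans _ _ (c * bdist G' (f x) * bdist G x)).
    by rewrite ler_pM2r.
  rewrite -!mulrA [leRHS]mulrCA ler_pM2l; last by lra.
  rewrite [leRHS]mulrCA [leRHS]mulrA [leRHS]mulrC -mulrA ler_pM2l//.
  by rewrite mulrA; lra.
(* Outside G, w would be at distance at least d_G(x) / c, against 2 lam |x-w| <= d_G(x) and c <=
   lam. *)
have Gw : G w.
  apply: contrapT => /(quasiconvex_bdist qX oG Gx) h.
  nra.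
have nD'w : ~ D' (f w) by move=> /(fD _ Gw).
have h := quasiconvex_bdist qY oD' D'x nD'w.
have h2 := flip x w Gx Gw xw.
apply: (@le_trans _ _ (c * (mdist (f x) (f w) * bdist G x))).
  by rewrite mulrA ler_pM2r.
apply: (@le_trans _ _ (c * (lam * mdist x w * bdist G' (f x)))).
  by rewrite ler_pM2l//; lra.
have : 0 <= c * (lam * mdist x w * bdist G' (f x)).
  by rewrite !mulr_ge0//; lra.
lra.
Qed.

(** One factor lam of the step ratio pays for the Lipschitz constant of f, the factor 2 c lam for
    passing from G, G' to D, D'. *)
Lemma step_image (R : realType) (X Y : metricType R) (c lam eps : R)
    (G D : set X) (G' D' : set Y) (f : X -> Y) (u v : X) :
  1 <= lam -> 0 <= eps -> eps <= 1 -> half_setting c lam G D G' D' f ->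
  (forall x, D x ->
    bdist D x * bdist G' (f x) <= 2 * c * lam * bdist D' (f x) * bdist G x) ->
  step D (eps / (2 * c * lam ^+ 2)) u v -> step D' eps (f u) (f v).
Proof.
move=> l1 e0 e1 [[qX oG oD BG BD] DG fG fD flip] H.
have [c1 _] := qX.
have S w z : D w -> D z -> mdist w z <= eps / (2 * c * lam ^+ 2) * bdist D w ->
    mdist (f w) (f z) <= eps * bdist D' (f w).
  move=> Dw Dz; rewrite mulrAC ler_pdivlMr; last by rewrite !mulr_gt0//; lra.
  move=> wz; have dw := bdist_subset qX oD oG BG DG Dw.
  have d0 := bdist_gt0 oG BG (DG _ Dw).
  have wz0 := mdist_ge0 w z.
  have dD0 := bdist_ge0 D w.
  have h1 : 2 * lam * mdist w z <= bdist G w.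
    have c0 : 0 < c by lra.
    rewrite -(ler_pM2l c0); apply: (le_trans _ dw).
    have l0 : 0 < lam by lra.
    have k1 : c * (2 * lam * mdist w z) <= mdist w z * (2 * c * lam ^+ 2).
      have -> : c * (2 * lam * mdist w z) = (c * lam * mdist w z) * 2 by ring.
      have -> : mdist w z * (2 * c * lam ^+ 2) = (c * lam * mdist w z) * (2 * lam) by ring.
      by rewrite ler_wpM2l//; [rewrite !mulr_ge0// ltW|lra].
    apply: (le_trans k1); apply: (le_trans wz).
    by rewrite ler_piMl.
  have h2 := flip _ _ (DG _ Dw) (DG _ Dz) h1.
  have h3 := H _ Dw.
  rewrite -(ler_pM2r d0); apply: (le_trans h2).
  have cl0 : 0 < 2 * c * lam by rewrite !mulr_gt0//; lra.
  rewrite -(ler_pM2l cl0).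
  have -> : 2 * c * lam * (lam * mdist w z * bdist G' (f w)) =
    (mdist w z * (2 * c * lam ^+ 2)) * bdist G' (f w) by ring.
  apply: (@le_trans _ _ (eps * bdist D w * bdist G' (f w))).
    by rewrite ler_wpM2r// bdist_ge0.
  rewrite -mulrA; have := ler_wpM2l e0 h3; lra.
move=> [Du Dv uv vu]; split; [exact/(fD _ (DG _ Du)) |exact/(fD _ (DG _ Dv)) |exact: S|].
by rewrite metric_sym; apply: S => //; rewrite metric_sym.
Qed.

Lemma chain_mdist (R : realType) (X : metricType R) (U : set X) (eta : R)
    (n : nat) (x y : X) : 0 <= eta -> chain (step U eta) n x y ->
  mdist x y <= (1 + eta) ^+ n * bdist U x.
Proof.
move=> e0 [z [<- <- zE]].
(* The induction carries the growth of the boundary distance along with the sharper geometric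
   sum. *)
suff : mdist (z 0%N) (z n) <= ((1 + eta) ^+ n - 1) * bdist U (z 0%N) /\
    bdist U (z n) <= (1 + eta) ^+ n * bdist U (z 0%N).
  by move=> [h _]; have := bdist_ge0 U (z 0%N); lra.
elim: n zE => [|n IH] zE.
  by rewrite expr0 subrr mul0r mul1r mdistxx lexx.
have [|h1 h2] := IH; first by move=> i iln; apply/zE/ltnW.
have [_ _ h3 _] := zE n (leqnn _).
have h4 := metric_triangle (z 0%N) (z n) (z n.+1).
have h5 := bdist_lip U (z n.+1) (z n); rewrite metric_sym in h5.
have h6 := ler_wpM2l e0 h2.
rewrite exprS; split; lra.
Qed.


Lemma exists_exp_ge (R : realType) (q a : R) : 1 < q -> exists k, a <= q ^+ k.
Proof.
move=> q1; pose k := Num.bound (`|a| / (q - 1)); exists k.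
have q0 : 0 < q - 1 by lra.
have h := bernoulli_le k (ltW q0).
have : `|a| / (q - 1) < k%:R by apply: archi_boundP; rewrite divr_ge0// ltW.
rewrite ltr_pdivrMr// => h2; have h3 := ler_norm a.
have E : 1 + (q - 1) = q by ring.
by rewrite E in h; lra.
Qed.

(* Pulling back a chain of G' along g bounds |g x - g y| in G; comparing the
   two boundary distances turns this into a bound in D. *)
Lemma half_setting_expansion (R : realType) (X Y : metricType R)
    (c lam b : R) (k : nat) (G D : set X) (G' D' : set Y) (g : Y -> X)
    (x y : Y) :
  c <= lam -> 1 <= lam -> 1 <= b ->
  3 / 2 <= (1 + (2 * lam)^-1 / (2 * (1 + 2 * b))) ^+ k ->
  half_setting c lam G' D' G D g ->
  uniform_domain b G' ->
  (forall z, D' z ->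
    bdist G (g z) * bdist D' z <= 2 * c * lam * bdist D (g z) * bdist G' z) ->
  D' x -> D' y -> 0 < bdist D (g x) ->
  mdist (g x) (g y) / bdist D (g x) <= 2 * (2 * c * lam) * lam *
    (4 * b ^+ 2 * c ^+ 2 * ((1 + mdist x y / bdist D' x) *
                            (1 + mdist x y / bdist D' y))) ^+ k.+1.
Proof.
move=> cl l1 b1 kq [[qY oG' oD' BG' BD'] DG' gG gD glip] unif F8 D'x D'y dgx.
have [c1 _] := qY.
have G'x := DG' _ D'x; have G'y := DG' _ D'y.
have r0 := mdist_ge0 x y; set r := mdist x y in r0 *.
have dx0 := bdist_gt0 oD' BD' D'x; have dy0 := bdist_gt0 oD' BD' D'y.
have gx0 := bdist_gt0 oG' BG' G'x; have gy0 := bdist_gt0 oG' BG' G'y.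
have rx0 : 0 <= r / bdist D' x by rewrite divr_ge0// ltW.
have ry0 : 0 <= r / bdist D' y by rewrite divr_ge0// ltW.
set A := (1 + _) * _.
have A1 : 1 <= A by rewrite -[leLHS]mulr1 /A; apply: ler_pM; lra.
have Ax : r / bdist D' x <= A.
  apply: (@le_trans _ _ ((1 + r / bdist D' x) * 1)); first by lra.
  by rewrite /A ler_wpM2l//; lra.
set e := (2 * lam)^-1 / _ in kq.
have i0 : 0 < (2 * lam)^-1 by rewrite invr_gt0; lra.
have i1 : (2 * lam)^-1 <= 1 by rewrite invf_le1; lra.
have e0 : 0 < e by rewrite divr_gt0//; lra.
(* The ratio 1 / (2 lam) is the scale at which [scaled_lip] applies to g. Images of such steps have
   ratio 1/2. *)
have [n ch nE] := uniform_chain i0 i1 b1 BG' unif G'x G'y.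
rewrite -/e -/r in nE.
have cmp z : D' z -> 1 + r / bdist G' z <= c * (1 + r / bdist D' z).
  move=> D'z; have dz0 := bdist_gt0 oD' BD' D'z.
  have gz0 := bdist_gt0 oG' BG' (DG' _ D'z).
  have h := bdist_subset qY oD' oG' BG' DG' D'z.
  have : r / bdist G' z <= c * (r / bdist D' z).
    by rewrite mulrA ler_pdivlMr// mulrAC ler_pdivrMr// -mulrA [leRHS]mulrC -mulrA ler_wpM2l// mulrC.
  lra.
have nA : (1 + e) ^+ n <= 4 * b ^+ 2 * c ^+ 2 * A.
  apply: (le_trans nE).
  have -> : 4 * b ^+ 2 * c ^+ 2 * A = 4 * b ^+ 2 * (c * (1 + r / bdist D' x)) * (c * (1 + r / bdist D' y)).
    by rewrite /A; ring.
  have p1 : 0 <= r / bdist G' x by rewrite divr_ge0// ltW.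
  have p2 : 0 <= r / bdist G' y by rewrite divr_ge0// ltW.
  have b20 : 0 <= 4 * b ^+ 2 by rewrite mulr_ge0// exprn_ge0//; lra.
  have p1' : 0 <= 1 + r / bdist G' x by lra.
  have p2' : 0 <= 1 + r / bdist G' y by lra.
  apply: ler_pM; rewrite ?cmp//; first by rewrite mulr_ge0.
  by apply: ler_pM; rewrite ?cmp.
set B := 4 * b ^+ 2 * c ^+ 2 * A in nA *.
have ch2 : chain (step G (1 / 2)) n (g x) (g y).
  apply: chain_map ch => u v [Gu Gv uv vu].
  have S w z : G' w -> G' z -> mdist w z <= (2 * lam)^-1 * bdist G' w ->
      mdist (g w) (g z) <= 1 / 2 * bdist G (g w).
    move=> Gw Gz wz; have dw0 := bdist_gt0 oG' BG' Gw.
    have l0 : 0 < 2 * lam by lra.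
    rewrite ler_pdivlMl// in wz.
    have h := glip _ _ Gw Gz wz.
    rewrite -(ler_pM2r dw0); apply: (le_trans h).
    have := ler_wpM2r (bdist_ge0 G (g w)) wz; lra.
  split; [exact: gG|exact: gG|exact: S|].
  by rewrite metric_sym; apply: S => //; rewrite metric_sym.
(* Each step in G enlarges the boundary distance by at most 3/2 <= (1 + e) ^ k, so the logarithmic
   bound on n becomes a power of B. *)
have h1 : mdist (g x) (g y) <= B ^+ k * bdist G (g x).
  have half0 : 0 <= 1 / 2 :> R by lra.
  apply: (le_trans (chain_mdist half0 ch2)).
  rewrite ler_wpM2r ?bdist_ge0//.
  apply: (@le_trans _ _ ((3 / 2) ^+ n)).
    have -> : 1 + 1 / 2 = 3 / 2 :> R by lra.
    by [].
  have p i : 0 <= (1 + e) ^+ i by rewrite exprn_ge0// addr_ge0// ltW.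
  apply: (@le_trans _ _ (((1 + e) ^+ k) ^+ n)).
    by rewrite lerXn2r ?nnegrE// divr_ge0.
  by rewrite exprAC lerXn2r ?nnegrE//; exact: le_trans (p n) nA.
have AB : A <= B.
  rewrite /B -[leLHS]mul1r ler_wpM2r//; first by lra.
  have : 1 <= b ^+ 2 by rewrite exprn_ege1.
  have : 1 <= c ^+ 2 by rewrite exprn_ege1.
  nra.
have B1 : 1 <= B by lra.
have Bk : 1 <= B ^+ k by rewrite exprn_ege1.
have F8x := F8 _ D'x.
rewrite ler_pdivrMr//.
have gxy0 := mdist_ge0 (g x) (g y).
have dg0 := bdist_ge0 G (g x).
set K := 2 * c * lam in F8x *.
have l0 : 0 < lam by lra.
have c0 : 0 < c by lra.
have K0 : 0 < K by rewrite /K !mulr_gt0.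
clearbody K.
have Bk0 : 0 < B ^+ k := lt_le_trans ltr01 Bk.
have glr := glip _ _ G'x G'y; rewrite -/r in glr.
clearbody A B r.
have rK : r <= A * bdist D' x by rewrite -ler_pdivrMr.
(* For close points the Lipschitz bound for g applies directly. For the others d_G'(x) is at most 2
   lam r, and F8 turns [h1] into a bound relative to D. *)
have [rs|rb] := leP (2 * lam * r) (bdist G' x).
  have h := glr rs.
  have P0 : 0 < bdist G' x * bdist D' x by rewrite mulr_gt0.
  rewrite -(ler_pM2r P0) mulrA.
  apply: (@le_trans _ _ (lam * r * bdist G (g x) * bdist D' x)).
    by rewrite ler_pM2r.
  apply: (@le_trans _ _ (lam * r * (K * bdist D (g x) * bdist G' x))).
    by rewrite -mulrA ler_wpM2l// mulr_ge0// ltW.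
  apply: (@le_trans _ _ (lam * (A * bdist D' x) * (K * bdist D (g x) * bdist G' x))).
    have Z0 : 0 <= K * bdist D (g x) * bdist G' x.
      by rewrite !mulr_ge0 ?ltW//.
    by rewrite ler_wpM2r// ler_pM2l.
  have -> : lam * (A * bdist D' x) * (K * bdist D (g x) * bdist G' x) =
    A * (lam * K * bdist D (g x) * (bdist G' x * bdist D' x)) by ring.
  have -> : 2 * K * lam * B ^+ k.+1 * bdist D (g x) * (bdist G' x * bdist D' x) =
    (2 * B ^+ k.+1) * (lam * K * bdist D (g x) * (bdist G' x * bdist D' x)) by ring.
  rewrite ler_pM2r ?mulr_gt0// exprS; nra.
rewrite -(ler_pM2r dx0).
apply: (@le_trans _ _ (B ^+ k * (bdist G (g x) * bdist D' x))).
  by rewrite mulrA ler_pM2r.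
apply: (@le_trans _ _ (B ^+ k * (K * bdist D (g x) * (2 * lam * r)))).
  rewrite ler_pM2l//.
  by apply: (le_trans F8x); rewrite ler_pM2l ?mulr_gt0// ltW.
apply: (@le_trans _ _ (B ^+ k * (K * bdist D (g x) * (2 * lam * (B * bdist D' x))))).
  rewrite ler_pM2l// ler_pM2l ?mulr_gt0// ler_pM2l ?mulr_gt0//.
  by apply: (le_trans rK); rewrite ler_pM2r.
by rewrite exprS le_eqVlt; apply/orP; left; apply/eqP; ring.
Qed.

(** A chain of D joins the preimages, by uniformity of D, and f carries it to D'. Its length is
    re-expressed through distances in D' by [half_setting_expansion], used from both end points. *)
Lemma image_chain (R : realType) (c b lam eps : R) :
  1 <= c -> 1 <= b -> c <= lam -> 0 < eps -> eps <= 1 ->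
  exists (q C : R) (p : nat), [/\ 1 < q, 1 <= C &
    forall (X Y : metricType R) (G D : set X) (G' D' : set Y)
      (f : X -> Y) (g : Y -> X),
    half_setting c lam G D G' D' f -> half_setting c lam G' D' G D g ->
    (forall x, G x -> g (f x) = x) -> (forall y, G' y -> f (g y) = y) ->
    uniform_domain b G' -> uniform_domain b D ->
    forall x y, D' x -> D' y -> exists2 n, chain (step D' eps) n x y &
      q ^+ n <= C *
        (1 + mdist x y / Order.min (bdist D' x) (bdist D' y)) ^+ p].
Proof.
move=> c1 b1 cl e0 e1.
have l1 : 1 <= lam by lra.
have den0 : 0 < 2 * c * lam ^+ 2 by rewrite !mulr_gt0//; lra.
pose eta := eps / (2 * c * lam ^+ 2).
have eta0 : 0 < eta by rewrite divr_gt0.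
have eta1 : eta <= 1.
  rewrite ler_pdivrMr// mul1r.
  have : 1 <= lam ^+ 2 by rewrite exprn_ege1.
  nra.
pose e := (2 * lam)^-1 / (2 * (1 + 2 * b)).
have ee0 : 0 < e by rewrite divr_gt0 ?invr_gt0//; lra.
have [k kE] : exists k, 3 / 2 <= (1 + e) ^+ k by apply: exists_exp_ge; lra.
pose K := 2 * (2 * c * lam) * lam.
have K0 : 0 < K by rewrite /K !mulr_gt0//; lra.
pose B := 4 * b ^+ 2 * c ^+ 2.
have bb1 : 1 <= b ^+ 2 by rewrite exprn_ege1.
have cc1 : 1 <= c ^+ 2 by rewrite exprn_ege1.
have B1 : 1 <= B by rewrite /B; nra.
have Bk1 : 1 <= B ^+ k.+1 by rewrite exprn_ege1.
pose C1 := 1 + K * B ^+ k.+1.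
have C11 : 1 <= C1 by rewrite /C1 lerDl mulr_ge0 ?exprn_ge0 ?ltW//; lra.
(* The base comes from [uniform_chain] in D. Each of the two factors there is at most C1 t ^ (2 (k +
   1)), with t the final ratio. *)
exists (1 + eta / (2 * (1 + 2 * b))), (4 * b ^+ 2 * C1 ^+ 2), (2 * (k.+1 * 2))%N; split.
- by rewrite ltrDl divr_gt0//; lra.
- have : 1 <= C1 ^+ 2 by rewrite exprn_ege1.
  nra.
move=> X Y G D G' D' f g hf hg gf fg uG' uD x y D'x D'y.
have [[qX oG oD BG BD] DG fG fD flip] := hf.
have [[qY oG' oD' BG' BD'] DG' gG gD glip] := hg.
have G'x := DG' _ D'x; have G'y := DG' _ D'y.
have Dgx : D (g x) by apply/gD.
have Dgy : D (g y) by apply/gD.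
have F8 z : D' z -> bdist G (g z) * bdist D' z <=
    2 * c * lam * bdist D (g z) * bdist G' z.
  move=> D'z; have Dgz : D (g z) by apply/gD => //; apply: DG'.
  have := bdist_image cl hf qY oG' oD' BG' DG' Dgz.
  by rewrite fg ?(mulrC (bdist D' z))//; exact: DG'.
have F8' z : D z -> bdist D z * bdist G' (f z) <=
    2 * c * lam * bdist D' (f z) * bdist G z.
  move=> Dz; have D'fz : D' (f z) by apply/fD => //; apply: DG.
  have := bdist_image cl hg qX oG oD BG DG D'fz.
  by rewrite gf//; exact: DG.
have [n ch nE] := uniform_chain eta0 eta1 b1 BD uD Dgx Dgy.
exists n.
  rewrite -[x]fg// -[y]fg//; apply: chain_map ch => u v.
  exact: (step_image l1 (ltW e0) e1 hf F8').
have Ex := half_setting_expansion cl l1 b1 kE hg uG' F8 D'x D'y (bdist_gt0 oD BD Dgx).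
have Ey := half_setting_expansion cl l1 b1 kE hg uG' F8 D'y D'x (bdist_gt0 oD BD Dgy).
rewrite -/K -/B in Ex Ey.
rewrite [mdist (g y) _]metric_sym [mdist y x]metric_sym in Ey.
rewrite [X in B * X]mulrC in Ey.
apply: (le_trans nE).
have dx0 := bdist_gt0 oD' BD' D'x; have dy0 := bdist_gt0 oD' BD' D'y.
have r0 := mdist_ge0 x y.
set t := 1 + mdist x y / Order.min _ _.
have t0 : 1 <= t by rewrite lerDl divr_ge0// le_min !ltW.
have tx : 1 + mdist x y / bdist D' x <= t.
  by rewrite lerD2l ler_wpM2l// lef_pV2 ?posrE ?lt_min ?dx0// ge_min lexx.
have ty : 1 + mdist x y / bdist D' y <= t.
  by rewrite lerD2l ler_wpM2l// lef_pV2 ?posrE ?lt_min ?dx0// ge_min lexx orbT.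
have tA : (1 + mdist x y / bdist D' x) * (1 + mdist x y / bdist D' y) <= t ^+ 2.
  by rewrite expr2; apply: ler_pM => //; rewrite addr_ge0// divr_ge0// ltW.
set A := (1 + _) * _ in tA Ex Ey.
have A0 : 0 <= A by rewrite /A mulr_ge0// addr_ge0// divr_ge0// ltW.
have tk1 : 1 <= t ^+ (k.+1 * 2) by rewrite exprn_ege1.
have Q s : s <= K * (B * A) ^+ k.+1 -> 1 + s <= C1 * t ^+ (k.+1 * 2).
  move=> h; have : s <= K * B ^+ k.+1 * t ^+ (k.+1 * 2).
    apply: (le_trans h); rewrite exprMn mulrA ler_wpM2l//.
      by rewrite mulr_ge0 ?ltW//; lra.
    by rewrite mulnC exprM lerXn2r// nnegrE// exprn_ge0//; lra.
  by rewrite /C1; lra.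
have {}Ex := Q _ Ex; have {}Ey := Q _ Ey.
have -> : 4 * b ^+ 2 * C1 ^+ 2 * t ^+ (2 * (k.+1 * 2)) =
  4 * b ^+ 2 * (C1 * t ^+ (k.+1 * 2)) * (C1 * t ^+ (k.+1 * 2)).
  by rewrite mul2n -addnn exprD; ring.
have dgx0 : 0 <= mdist (g x) (g y) / bdist D (g x).
  by rewrite divr_ge0 ?mdist_ge0 ?bdist_ge0.
have dgy0 : 0 <= mdist (g x) (g y) / bdist D (g y).
  by rewrite divr_ge0 ?mdist_ge0 ?bdist_ge0.
have b40 : 0 <= 4 * b ^+ 2 by lra.
apply: ler_pM => //; [|by rewrite addr_ge0|by rewrite ler_wpM2l].
by rewrite mulr_ge0// addr_ge0.
Qed.

(** * Shortest chains *)

(** Exponentials outgrow polynomials: with m = N div (p + 1) and t = 1 + m e, Bernoulli gives q ^ N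
    >= t ^ (p + 1), while the right side is at most a constant times t ^ p. *)
Lemma exp_le_poly_bound (R : realType) (q C L : R) (p : nat) :
  1 < q -> 0 <= L -> exists K, forall N : nat,
    q ^+ N <= C * (1 + N%:R * L) ^+ p -> (N <= K)%N.
Proof.
move=> q1 L0; set e := q - 1; have e0 : 0 < e by rewrite /e; lra.
have qE : q = 1 + e by rewrite /e; ring.
set P : R := p.+1%:R; have P0 : 0 <= P by [].
set D := 1 + P * L + P * L / e.
have PL0 : 0 <= P * L by rewrite mulr_ge0.
have PLe0 : 0 <= P * L / e by rewrite divr_ge0// ltW.
have D0 : 0 < D by rewrite /D; lra.
set M := Num.bound (`|C| * D ^+ p / e).
have CD0 : 0 <= `|C| * D ^+ p by rewrite mulr_ge0// exprn_ge0// ltW.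
exists (M.+1 * p.+1)%N => N h.
rewrite leqNgt; apply/negP => NM.
set m := (N %/ p.+1)%N.
have Mm : (M < m)%N by rewrite /m leq_divRL// ltnW.
have Nm : (N <= m.+1 * p.+1)%N by apply/ltnW/ltn_ceil.
set t := 1 + m%:R * e.
have me0 : 0 <= m%:R * e by rewrite mulr_ge0// ltW.
have t1 : 1 <= t by rewrite /t; lra.
have h1 : t ^+ p.+1 <= q ^+ N.
  apply: (@le_trans _ _ ((q ^+ m) ^+ p.+1)).
    rewrite lerXn2r ?nnegrE ?exprn_ge0 //; [lra|lra|].
    by rewrite qE bernoulli_le// ltW.
  by rewrite -exprM ler_weXn2l ?leq_divM// ltW.
have h2 : 1 + N%:R * L <= D * t.
  have : N%:R * L <= (m%:R + 1) * P * L.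
    by rewrite ler_wpM2r// natr1 -natrM ler_nat.
  have : D * t = 1 + P * L + P * L / e + m%:R * e * (1 + P * L) + P * L * m%:R.
    rewrite /D /t; field; lra.
  have : 0 <= m%:R * e * (1 + P * L) by rewrite mulr_ge0//; lra.
  have : 0 <= m%:R :> R by [].
  nra.
have N0 : 0 <= N%:R * L by rewrite mulr_ge0.
have h3 : t ^+ p.+1 <= (`|C| * D ^+ p) * t ^+ p.
  apply: (le_trans h1); apply: (le_trans h).
  apply: (@le_trans _ _ (`|C| * (1 + N%:R * L) ^+ p)).
    by rewrite ler_wpM2r ?ler_norm// exprn_ge0//; lra.
  by rewrite -mulrA -exprMn ler_wpM2l// lerXn2r// nnegrE; lra.
rewrite exprS ler_pM2r in h3; last by rewrite exprn_gt0//; lra.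
have h4 : `|C| * D ^+ p / e < M%:R by apply: archi_boundP; rewrite divr_ge0// ltW.
rewrite ltr_pdivrMr// in h4.
have h5 : M%:R * e <= m%:R * e by rewrite ler_pM2r// ler_nat ltnW.
by rewrite /t in h3; lra.
Qed.

Lemma doubling_le (R : realType) (a : nat -> R) (n : nat) :
  (forall i, (i < n)%N -> a i <= 2 * a i.+1) ->
  forall j i, (j <= i)%N -> (i <= n)%N -> a j <= 2 ^+ (i - j) * a i.
Proof.
move=> H j i ji iin; rewrite -(subnKC ji) in iin *.
elim: (i - j)%N iin => [|k IH] iin; first by rewrite addn0 subnn expr0 mul1r.
rewrite addnS in iin *; apply: (le_trans (IH (ltnW iin))).
rewrite subSn ?leq_addr// exprSr -mulrA ler_wpM2l ?exprn_ge0//.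
exact: H.
Qed.

(* Before its maximum the sequence grows at a geometric rate: a long stretch on
   which it stays within a bounded factor of its end values is excluded by
   [short]. *)
Lemma rising_sum_le (R : realType) (K : R -> nat) : exists2 C : R, 1 <= C &
  forall (a : nat -> R) (n m : nat), (m <= n)%N ->
  (forall i, (i <= n)%N -> 0 < a i) ->
  (forall i, (i < n)%N -> a i.+1 <= 2 * a i) ->
  (forall i, (i < n)%N -> a i <= 2 * a i.+1) ->
  forall short : (forall (L : R) i j, (i <= j)%N -> (j <= n)%N ->
    (forall k, (i <= k <= j)%N -> a k <= L * a i /\ a k <= L * a j) ->
    (j - i <= K L)%N),
  (forall i, (i <= n)%N -> a i <= a m) ->
  forall i, (i <= m)%N -> \sum_(j < i.+1) a j <= C * a i.
Proof.
pose P : R := 2 ^+ K 2; pose L := (K (2 * P)).+1.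
have P1 : 1 <= P by rewrite exprn_ege1// ler1n.
have L1 : 1 <= L%:R :> R by rewrite ler1n.
exists (2 * L%:R * P); first by nra.
move=> a n m mn a0 aS Sa short am.
(* Suppose a dips below a j at i. The last index up to i and the first index from i on with value at
   least a j bound a stretch where a <= 2 a j. Its length is at most K 2, and doubling bounds the
   dip. *)
have quasimono j i : (j <= i)%N -> (i <= m)%N -> a j <= P * a i.
  move=> ji im; have iin := leq_trans im mn.
  have ai0 := a0 _ iin.
  have [aji|aij] := leP (a j) (a i); first by nra.
  pose Q k := (k <= i)%N && (a j <= a k).
  have Qex : exists k, Q k by exists j; rewrite /Q ji lexx.
  have Qub k : Q k -> (k <= i)%N by move=> /andP[].
  case: (ex_maxnP Qex Qub) => j' /andP[j'i ajj'] j'max.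
  pose Q' k := (i <= k)%N && (a j <= a k).
  have Qex' : exists k, Q' k.
    by exists m; rewrite /Q' im am// (leq_trans ji).
  case: (ex_minnP Qex') => l /andP[il ajl] lmin.
  have lm : (l <= m)%N by apply: lmin; rewrite /Q' im am// (leq_trans ji).
  have ln := leq_trans lm mn.
  have j'i' : (j' < i)%N.
    by rewrite ltn_neqAle j'i andbT; apply/eqP => E; rewrite E leNgt aij in ajj'.
  have il' : (i < l)%N.
    by rewrite ltn_neqAle il andbT; apply/eqP => E; rewrite -E leNgt aij in ajl.
  have low1 k : (j' < k)%N -> (k <= i)%N -> a k < a j.
    move=> j'k ki; rewrite ltNge; apply/negP => ajk.
    by have := j'max k; rewrite /Q ki ajk => /(_ isT); rewrite leqNgt j'k.
  have low2 k : (i <= k)%N -> (k < l)%N -> a k < a j.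
    move=> ik kl; rewrite ltNge; apply/negP => ajk.
    by have := lmin k; rewrite /Q' ik ajk => /(_ isT); rewrite leqNgt kl.
  have up k : (j' <= k <= l)%N -> a k <= 2 * a j.
    have aj0 : 0 < a j by apply: a0; apply: leq_trans iin.
    move=> /andP[]; rewrite leq_eqVlt => /orP[/eqP <- _|j'k].
      have := Sa j'; have := low1 j'.+1 (ltnSn _) j'i'.
      move=> h1 h2; have {}h2 := h2 (leq_trans j'i' iin); lra.
    rewrite leq_eqVlt => /orP[/eqP ->|kl].
      case: l il' ln low2 {ajl lmin lm il} => // l il' ln low2.
      have := aS l ln; have := low2 l il' (ltnSn _); lra.
    have [ki|ik] := leqP k i; first by have := low1 k j'k ki; lra.
    by have := low2 k (ltnW ik) kl; lra.
  have := short 2 j' l (leq_trans j'i il) ln.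
  have H k : (j' <= k <= l)%N -> a k <= 2 * a j' /\ a k <= 2 * a l.
    by move=> /up h; split; lra.
  move=> /(_ H) lK.
  apply: (le_trans ajj'); apply: (le_trans (doubling_le Sa j'i iin)).
  rewrite ler_pM2r// /P ler_weXn2l ?ler1n//.
  by apply: leq_trans lK; apply: leq_sub2r.
(* Otherwise all values between j and i are at most 2 P times either end value, and [short] forces i
   - j < L. *)
have halving j i : (j <= i)%N -> (i <= m)%N -> (L <= i - j)%N -> a j <= a i / 2.
  move=> ji im Lij; rewrite leNgt; apply/negP => h.
  suff : (i - j <= K (2 * P)%R)%N by rewrite leqNgt Lij.
  apply: short => //; first exact: leq_trans mn.
  move=> k /andP[jk ki]; have h1 := quasimono _ _ ki im.
  have ai0 := a0 _ (leq_trans im mn).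
  by split; nra.
have part i k : (k <= i.+1)%N -> (i <= m)%N ->
    \sum_(k <= j < i.+1) a j <= (i.+1 - k)%:R * (P * a i).
  move=> ki im.
  apply: (@le_trans _ _ (\sum_(k <= j < i.+1) (P * a i))).
    by apply: ler_sum_nat => j /andP[kj ji]; apply: quasimono.
  by rewrite big_const_nat iter_addr_0 mulr_natl.
(* The last L terms add up to at most L P a i. The earlier ones are at most C a (i - L) <= C a i /
   2, again L P a i. *)
elim/ltn_ind => i IH im.
have ai0 := a0 _ (leq_trans im mn).
have [iL|Li] := leqP i.+1 L.
  rewrite -(big_mkord xpredT a); apply: (le_trans (part i 0%N (leq0n _) im)).
  rewrite subn0 mulrA ler_pM2r// ler_pM2r; last by lra.
  have : i.+1%:R <= L%:R :> R by rewrite ler_nat.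
  lra.
rewrite ltnS in Li.
have L0 : (0 < L)%N by [].
have iLi : (i - L < i)%N by rewrite ltn_subrL L0 (leq_trans L0).
have iLm : (i - L <= m)%N by apply: leq_trans im; apply: leq_subr.
rewrite -(big_mkord xpredT a) (@big_cat_nat _ _ _ (i - L).+1)//=; last exact: leqW.
have h1 := IH _ iLi iLm; rewrite -(big_mkord xpredT a) in h1.
have h2 := part i (i - L).+1 (leqW iLi) im.
rewrite subSS subKn// in h2.
have h3 : a (i - L)%N <= a i / 2.
  by apply: halving => //; [exact: leq_subr|rewrite subKn].
have LP0 : 0 <= L%:R * P by nra.
apply: (le_trans (lerD h1 h2)).
have := ler_wpM2l LP0 h3; lra.
Qed.

(** The index m is one of maximal value. The falling side is [rising_sum_le] applied to the reversed
    sequence. *)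
Lemma unimodal_sum_le (R : realType) (K : R -> nat) : exists2 C : R, 1 <= C &
  forall (a : nat -> R) (n : nat),
  (forall i, (i <= n)%N -> 0 < a i) ->
  (forall i, (i < n)%N -> a i.+1 <= 2 * a i) ->
  (forall i, (i < n)%N -> a i <= 2 * a i.+1) ->
  forall short : (forall (L : R) i j, (i <= j)%N -> (j <= n)%N ->
    (forall k, (i <= k <= j)%N -> a k <= L * a i /\ a k <= L * a j) ->
    (j - i <= K L)%N),
  exists m, [/\ (m <= n)%N, forall i, (i <= n)%N -> a i <= a m,
    forall i, (i <= m)%N -> \sum_(j < i.+1) a j <= C * a i &
    forall i, (m <= i)%N -> (i <= n)%N -> \sum_(i <= j < n.+1) a j <= C * a i].
Proof.
have [C C1 H] := rising_sum_le K; exists C => // a n a0 aS Sa short.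
have [m mn am] : exists2 m, (m <= n)%N & forall i, (i <= n)%N -> a i <= a m.
  elim: n {a0 aS Sa short} => [|n [m mn IH]].
    by exists 0%N => // i; rewrite leqn0 => /eqP ->.
  have [h|h] := leP (a n.+1) (a m).
    exists m; first exact: leqW.
    by move=> i; rewrite leq_eqVlt => /orP[/eqP -> //|]; exact: IH.
  exists n.+1 => // i; rewrite leq_eqVlt => /orP[/eqP -> //|iin].
  by apply: le_trans (IH _ iin) _; exact: ltW.
exists m; split=> //; first exact: (H a n m).
move=> i mi iin.
have nK k : (k <= n)%N -> (n - (n - k) = k)%N by move=> kn; rewrite subKn.
have rev0 k : (k <= n)%N -> 0 < a (n - k)%N by move=> kn; apply/a0/leq_subr.
have revS k : (k < n)%N -> a (n - k.+1)%N <= 2 * a (n - k)%N.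
  by move=> kn; rewrite -(subnSK kn); apply: Sa; rewrite subnSK// leq_subr.
have Srev k : (k < n)%N -> a (n - k)%N <= 2 * a (n - k.+1)%N.
  by move=> kn; rewrite -(subnSK kn); apply: aS; rewrite subnSK// leq_subr.
have revshort (L : R) u v : (u <= v)%N -> (v <= n)%N ->
    (forall k, (u <= k <= v)%N ->
      a (n - k)%N <= L * a (n - u)%N /\ a (n - k)%N <= L * a (n - v)%N) ->
    (v - u <= K L)%N.
  move=> uv vn h; have un := leq_trans uv vn.
  have -> : (v - u = (n - u) - (n - v))%N by lia.
  apply: short; [exact: leq_sub2l|exact: leq_subr|] => k /andP[vk ku].
  have kn : (k <= n)%N by lia.
  by have := h (n - k)%N; rewrite nK// => h'; have [] := h' ltac:(lia); split.
have revm k : (k <= n)%N -> a (n - k)%N <= a (n - (n - m))%N.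
  by move=> kn; rewrite nK//; apply/am/leq_subr.
have := H (fun k => a (n - k)%N) n (n - m)%N (leq_subr _ _) rev0 revS Srev
  revshort revm (n - i)%N (leq_sub2l _ mi).
rewrite nK// big_rev_mkord subSn//.
Qed.

(* A chain is almost minimal when no two of its points can be joined by a much
   shorter chain; by [image_chain] the length of such a shorter chain is
   logarithmic, so that an almost minimal chain is a discrete quasihyperbolic
   geodesic and the argument of Gehring and Osgood applies to it. *)
Lemma geodesic_chain (R : realType) (q C eps : R) (p : nat) :
  1 < q -> 1 <= C -> 0 < eps -> eps <= 1 -> exists2 C', 1 <= C' &
  forall (Y : metricType R) (D : set Y) (z : nat -> Y) (n : nat),
  (forall y, D y -> 0 < bdist D y) -> (forall i, (i <= n)%N -> D (z i)) ->
  (forall i, (i < n)%N -> step D eps (z i) (z i.+1)) ->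
  (forall i j, (i <= j)%N -> (j <= n)%N ->
    q ^+ (j - i) <= C * (1 + mdist (z i) (z j) /
                             Order.min (bdist D (z i)) (bdist D (z j))) ^+ p) ->
  (forall i, (i <= n)%N ->
    \sum_(j < i.+1) bdist D (z j) <= C' * bdist D (z i) \/
    \sum_(i <= j < n.+1) bdist D (z j) <= C' * bdist D (z i)) /\
  (~ step D eps (z 0%N) (z n) ->
    \sum_(j < n.+1) bdist D (z j) <= C' * mdist (z 0%N) (z n)).
Proof.
move=> q1 C1 e0 e1.
have [K KE] : exists K : R -> nat, forall L, 0 <= L -> forall N : nat,
    q ^+ N <= C * (1 + N%:R * L) ^+ p -> (N <= K L)%N.
  have /choice[K KE] : forall L : R, exists k : nat, 0 <= L -> forall N : nat,
      q ^+ N <= C * (1 + N%:R * L) ^+ p -> (N <= k)%N.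
    move=> L; have [L0|L0] := leP 0 L.
      by have [k kE] := exp_le_poly_bound C p q1 L0; exists k.
    by exists 0%N.
  by exists K.
have [C2 C21 H] := unimodal_sum_le K.
(* In units of [E * r], S bounds the distance between the first and last points at which the
   boundary distance is at least [E * r]: 2 C2 for each end stretch, 1 for r itself. *)
pose S := 4 * C2 + 1.
have [K3 K3E] := exp_le_poly_bound (C * (1 + S) ^+ p) 0 q1 (lexx (0 : R)).
pose E := eps^-1 + 1.
have E1 : 1 <= E by rewrite /E lerDr invr_ge0 ltW.
have t1 : 1 <= 2 ^+ K3 :> R by rewrite exprn_ege1// ler1n.
pose C' := 4 * C2 * 2 ^+ K3 * E.
have tE : 1 <= 2 ^+ K3 * E by rewrite -[leLHS]mulr1 ler_pM.
have C'C2 : C2 <= C' by rewrite /C' -mulrA; nra.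
exists C'; first by lra.
move=> Y D z n dpos Dz zstep zgeo.
set a := fun i => bdist D (z i).
have a0 i : (i <= n)%N -> 0 < a i by move=> iin; apply/dpos/Dz.
have aS i : (i < n)%N -> a i.+1 <= 2 * a i.
  move=> iin; have [_ _ h _] := zstep i iin.
  have := bdist_lip D (z i.+1) (z i); rewrite metric_sym -/(a i) -/(a i.+1).
  have := a0 i (ltnW iin); rewrite /a in h *; nra.
have Sa i : (i < n)%N -> a i <= 2 * a i.+1.
  move=> iin; have [_ _ _ h] := zstep i iin.
  have := bdist_lip D (z i) (z i.+1); rewrite -/(a i) -/(a i.+1).
  have := a0 i.+1 iin; rewrite /a in h *; nra.
have zsum i j : (i <= j)%N -> (j <= n)%N ->
    mdist (z i) (z j) <= \sum_(i <= k < j) a k.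
  move=> ij; elim: j ij => [|j IH].
    by rewrite leqn0 => /eqP -> _; rewrite big_geq// mdistxx.
  rewrite leq_eqVlt => /orP[/eqP -> _|]; first by rewrite big_geq// mdistxx.
  rewrite ltnS => ij jn; rewrite big_nat_recr//=.
  have h1 := IH ij (ltnW jn); have [_ _ h2 _] := zstep j jn.
  have h3 := metric_triangle (z i) (z j) (z j.+1).
  have := a0 j (ltnW jn); rewrite /a in h1 h2 *; nra.
(* On such a stretch |z i - z j| is at most (j - i) L min (a i, a j), so the chain bound compares an
   exponential with a polynomial in j - i. *)
have short (L : R) i j : (i <= j)%N -> (j <= n)%N ->
    (forall k, (i <= k <= j)%N -> a k <= L * a i /\ a k <= L * a j) ->
    (j - i <= K L)%N.
  move=> ij jn h; have iin := leq_trans ij jn.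
  have ai := a0 _ iin; have aj := a0 _ jn.
  have L0 : 0 <= L.
    have := h i; rewrite leqnn ij => /(_ isT)[+ _]; nra.
  apply: KE => //; apply: (le_trans (zgeo i j ij jn)).
  rewrite ler_wpM2l//; first by lra.
  have mpos : 0 < Order.min (a i) (a j) by rewrite lt_min ai.
  have h1 : mdist (z i) (z j) <= (j - i)%:R * (L * Order.min (a i) (a j)).
    apply: (le_trans (zsum i j ij jn)).
    apply: (@le_trans _ _ (\sum_(i <= k < j) (L * Order.min (a i) (a j)))).
      apply: ler_sum_nat => k /andP[ik kj].
      have [h1 h2] := h k ltac:(by rewrite ik ltnW).
      by rewrite minr_pMr// le_min h1.
    by rewrite big_const_nat iter_addr_0 mulr_natl.
  have m0 : 0 <= mdist (z i) (z j) / Order.min (a i) (a j).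
    by rewrite divr_ge0 ?mdist_ge0 ?ltW.
  have h2 : mdist (z i) (z j) / Order.min (a i) (a j) <= (j - i)%:R * L.
    by rewrite ler_pdivrMr// -mulrA.
  by rewrite lerXn2r ?nnegrE// ?lerD2l// addr_ge0// mulr_ge0.
have [m [mn am up down]] := H a n a0 aS Sa short.
have C20 : 0 <= C2 by lra.
split.
  move=> i iin; have ai := a0 _ iin; have [im|mi] := leqP i m; [left|right].
    by apply: (le_trans (up i im)); rewrite ler_pM2r.
  by apply: (le_trans (down i (ltnW mi) iin)); rewrite ler_pM2r.
move=> nstep; set r := mdist (z 0%N) (z n).
suff : \sum_(j < n.+1) a j <= C' * r by [].
have r0 : 0 <= r by apply: mdist_ge0.
have a00 := a0 _ (leq0n n); have an0 := a0 _ (leqnn n).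
(* The two values differ by at most r. If one exceeded E r, both would be at least r / eps, and the
   end points would form a step. *)
have ends : a 0%N <= E * r /\ a n <= E * r.
  have l1 := bdist_lip D (z 0%N) (z n); have l2 := bdist_lip D (z n) (z 0%N).
  rewrite (metric_sym (z n)) -/r -/(a 0%N) -/(a n) in l1 l2.
  have eE : E * r = eps^-1 * r + r by rewrite /E; ring.
  have ee : eps * (eps^-1 * r) = r by rewrite mulrA divff ?mul1r// gt_eqF.
  have er0 : 0 <= eps^-1 * r by rewrite mulr_ge0// invr_ge0 ltW.
  apply: contrapT => nE; apply: nstep; split; [exact: Dz|exact: Dz| |];
    rewrite -/r -/(a _) -ee ler_pM2l//; rewrite leNgt; apply/negP => h;
    apply: nE; rewrite eE; split; lra.
have [a0E anE] := ends.
have {}zgeo i j : (i <= j)%N -> (j <= n)%N ->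
    q ^+ (j - i) <= C * (1 + mdist (z i) (z j) / Order.min (a i) (a j)) ^+ p.
  exact: zgeo.
have rD : mdist (z 0%N) (z n) = r by [].
clearbody a E r.
have rE : r <= E * r by rewrite ler_peMl.
have total : \sum_(j < n.+1) a j <= 2 * C2 * a m.
  have h1 := up m (leqnn m); have h2 := down m (leqnn m) mn.
  rewrite -(big_mkord xpredT a) in h1; rewrite -(big_mkord xpredT a).
  rewrite (@big_cat_nat _ _ _ m)//=; last exact: leqW.
  rewrite big_nat_recr//= in h1.
  have := a0 m mn; lra.
suff amE : a m <= 2 * 2 ^+ K3 * (E * r).
  apply: (le_trans total).
  apply: (@le_trans _ _ (2 * C2 * (2 * 2 ^+ K3 * (E * r)))).
    by rewrite ler_wpM2l// mulr_ge0.
  by rewrite /C' le_eqVlt; apply/orP; left; apply/eqP; ring.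
have S0 : 0 <= S by rewrite addr_ge0// mulr_ge0.
have C0 : 0 <= C := le_trans ler01 C1.
set B := E * r in a0E anE rE *; have B0 : 0 <= B := le_trans r0 rE.
have Bt : B <= 2 ^+ K3 * B by rewrite ler_peMl.
clearbody B; clear ends total tE E1 t1 e0 e1 a00 nstep.
have [amB|Bam] := leP (a m) B; first by lra.
(* Take the first i and the last l with value at least B. The end stretches outside have length
   O(B), so z i and z l are O(B) apart, l - i is at most K3, and doubling from l back to m bounds a
   m. *)
pose Q k := (k <= n)%N && (B <= a k).
have Qm : Q m by rewrite /Q mn ltW.
have Qub k : Q k -> (k <= n)%N by move=> /andP[].
case: (ex_minnP (ex_intro Q m Qm)) => i /andP[iin Bi] imin.
case: (ex_maxnP (ex_intro Q m Qm) Qub) => l /andP[ln Bl] lmax.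
have im := imin _ Qm; have ml := lmax _ Qm.
have ai2 : a i <= 2 * B.
  case: i imin iin Bi im => [|i] imin iin Bi im; first by lra.
  have : a i < B.
    rewrite ltNge; apply/negP => h.
    by have := imin i; rewrite /Q h (ltnW iin) => /(_ isT); rewrite ltnn.
  have := aS i iin; lra.
have al2 : a l <= 2 * B.
  move: ln; rewrite leq_eqVlt => /orP[/eqP E0|ln']; first by rewrite E0; lra.
  have : a l.+1 < B.
    rewrite ltNge; apply/negP => h.
    by have := lmax l.+1; rewrite /Q h ln' => /(_ isT); rewrite ltnn.
  have := Sa l ln'; lra.
have xi : mdist (z 0%N) (z i) <= 2 * C2 * B.
  have h := zsum 0%N i (leq0n _) iin; have h2 := up i im.
  rewrite -(big_mkord xpredT a) big_nat_recr//= in h2.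
  have ai := a0 _ iin.
  apply: (le_trans h); apply: (@le_trans _ _ (C2 * a i)); first by lra.
  by have := ler_wpM2l C20 ai2; lra.
have ly : mdist (z l) (z n) <= 2 * C2 * B.
  have h := zsum l n ln (leqnn _); have h2 := down l ml ln.
  rewrite big_nat_recr//= in h2.
  apply: (le_trans h); apply: (@le_trans _ _ (C2 * a l)); first by lra.
  by have := ler_wpM2l C20 al2; lra.
have il : (i <= l)%N := leq_trans im ml.
have zil : mdist (z i) (z l) <= S * B.
  have h1 := metric_triangle (z i) (z 0%N) (z l).
  have h2 := metric_triangle (z 0%N) (z n) (z l).
  rewrite (metric_sym (z i) (z 0%N)) in h1; rewrite (metric_sym (z n)) rD in h2.
  rewrite /S; lra.
have lK : (l - i <= K3)%N.
  apply: K3E; rewrite expr0 mulr1; apply: (le_trans (zgeo i l il ln)).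
  rewrite ler_wpM2l//.
  have mB : B <= Order.min (a i) (a l) by rewrite le_min Bi.
  have mpos : 0 < Order.min (a i) (a l) by rewrite lt_min !a0.
  have h : mdist (z i) (z l) / Order.min (a i) (a l) <= S.
    rewrite ler_pdivrMr//; apply: (le_trans zil).
    by rewrite ler_wpM2l.
  have h0 : 0 <= mdist (z i) (z l) / Order.min (a i) (a l).
    by rewrite divr_ge0 ?mdist_ge0 ?ltW.
  by rewrite lerXn2r ?nnegrE ?lerD2l// addr_ge0.
apply: (le_trans (doubling_le Sa ml ln)).
have al0 : 0 <= a l := le_trans B0 Bl.
apply: (@le_trans _ _ (2 ^+ K3 * (2 * B))); last by lra.
apply: ler_pM => //.
by rewrite ler_weXn2l ?ler1n// (leq_trans _ lK)// leq_sub2l.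
Qed.

(** * Arcs along chains *)

(* The length of an arc is bounded through a function [phi] dominating the
   variation of [g]; unlike [path_length], such a bound is additive under
   concatenation by construction. *)
Definition controlled_arc (R : realType) (X : metricType R) (A : set X)
    (x y : X) (T : R) (g : R -> X) (phi : R -> R) : Prop :=
  [/\ arc_in A x y T g, phi 0 = 0 & forall s t, 0 <= s -> s <= t -> t <= T ->
    mdist (g s) (g t) <= phi t - phi s].

Lemma arc_controlled (R : realType) (X : metricType R) (A : set X) (x y : X)
    (T L : R) (g : R -> X) :
  arc_in A x y T g -> (path_length g 0 T <= L%:E)%E ->
  exists2 phi, controlled_arc A x y T g phi & phi T <= L.
Proof.
move=> Ag gL; have [T0 _ _ _ _] := Ag.
have fin t : 0 <= t -> t <= T -> path_length g 0 t \is a fin_num.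
  move=> t0 tT; rewrite ge0_fin_numE ?path_length_ge0//.
  apply: (@le_lt_trans _ _ L%:E); last by rewrite ltry.
  by apply: le_trans gL; exact: path_length_leL.
exists (fun t => fine (path_length g 0 t)); last first.
  by rewrite -lee_fin fineK ?fin.
split=> //; first by rewrite path_length_xx.
move=> s t s0 st tT; have t0 := le_trans s0 st; have sT := le_trans st tT.
by rewrite lerBrDl -lee_fin EFinD !fineK ?fin//; exact: path_length_rcons.
Qed.

(** The image of g2 is compact, hence closed, so the infimum of the parameters at which g1 meets it
    is attained. *)
Lemma first_hit (R : realType) (X : metricType R) (T1 T2 : R)
    (g1 g2 : R -> X) : 0 <= T1 -> 0 <= T2 ->
  {within `[0, T1], continuous g1} -> {within `[0, T2], continuous g2} ->
  g1 T1 = g2 0 ->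
  exists t1 s1, [/\ 0 <= t1 <= T1, 0 <= s1 <= T2, g1 t1 = g2 s1 &
    forall t s, 0 <= t -> t < t1 -> 0 <= s <= T2 -> g1 t <> g2 s].
Proof.
move=> T10 T20 c1 c2 E.
have K2 : closed (g2 @` `[0, T2]).
  apply: compact_closed; first exact: metric_hausdorff.
  by apply: continuous_compact => //; exact: segment_compact.
pose S := [set t | 0 <= t <= T1 /\ (g2 @` `[0, T2]) (g1 t)].
have ST1 : S T1.
  split; first by rewrite lexx T10.
  by exists 0; rewrite //= in_itv/= lexx T20.
have Slb : has_lbound S by exists 0 => t [/andP[]].
have hS : has_inf S by split; [exists T1|].
set t1 := inf S.
have t10 : 0 <= t1 by apply: lb_le_inf; [exists T1|move=> t [/andP[]]].
have t1T : t1 <= T1 by exact: ge_inf.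
have St1 : S t1.
  split; first by rewrite t10.
  apply: K2; rewrite /closure/= => B nB.
  have /subspace_continuousP/(_ t1) := c1.
  rewrite /= in_itv/= t10 t1T => /(_ isT) /(_ B nB).
  have H : nbhs t1 (fun t => 0 <= t <= T1 -> B (g1 t)) -> (g2 @` `[0, T2] `&` B !=set0).
    rewrite -(@filter_from_ballE R R) => -[e /= e0 he].
    have [t St tlt] := inf_adherent e0 hS.
    have t1t : t1 <= t by exact: ge_inf.
    exists (g1 t); split; first by case: St.
    apply: he; last by case: St.
    rewrite /ball/= ler0_norm; lra.
  move=> h; have h' : nbhs t1 (fun t => `[0, T1]%classic t -> B (g1 t)) := h.
  by apply: H; apply: filterS h' => t hB tT; apply: hB; rewrite /= in_itv.
have [_ [s1 /=]] := St1; rewrite in_itv/= => s1T Es.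
exists t1, s1; split=> //; first by rewrite t10.
move=> t s t0 tt1 s0 Ets; suff : t1 <= t by lra.
apply: ge_inf => //; split; first by apply/andP; split; lra.
by exists s => //=; rewrite in_itv.
Qed.

(** Injectivity is kept by switching from g1 to g2 at their first meeting point. The cut parameters
    and the formulas for g and phi are exported so that [chain_arc] can locate points of the new
    arc. *)
Lemma arc_cat (R : realType) (X : metricType R) (A : set X) (x y z : X)
    (T1 T2 : R) (g1 g2 : R -> X) (phi1 phi2 : R -> R) :
  controlled_arc A x y T1 g1 phi1 -> controlled_arc A y z T2 g2 phi2 ->
  exists (T : R) (g : R -> X) (phi : R -> R) (t1 s1 : R),
    [/\ controlled_arc A x z T g phi, 0 <= t1 <= T1, 0 <= s1 <= T2,
        T = t1 + (T2 - s1) &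
        (forall t, 0 <= t <= t1 -> g t = g1 t /\ phi t = phi1 t) /\
        (forall t, t1 <= t -> g t = g2 (t - t1 + s1) /\
           phi t = phi1 t1 + (phi2 (t - t1 + s1) - phi2 s1))].
Proof.
move=> [[T10 c1 i1 [g10 g1T] A1] p10 p1] [[T20 c2 i2 [g20 g2T] A2] p20 p2].
have [t1 [s1 [/andP[t10 t1T] /andP[s10 s1T] Es hit]]] :=
  first_hit T10 T20 c1 c2 (etrans g1T (esym g20)).
pose g t := if t <= t1 then g1 t else g2 (t - t1 + s1).
pose phi t := if t <= t1 then phi1 t else phi1 t1 + (phi2 (t - t1 + s1) - phi2 s1).
have E1 t : t <= t1 -> g t = g1 t /\ phi t = phi1 t.
  by rewrite /g /phi => ->.
have E2 t : t1 <= t -> g t = g2 (t - t1 + s1) /\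
    phi t = phi1 t1 + (phi2 (t - t1 + s1) - phi2 s1).
  rewrite /g /phi; case: ltgtP => // E0 _; have -> : t = t1 by lra.
  by rewrite subrr add0r subrr addr0 Es.
set T := t1 + (T2 - s1).
have t1T' : t1 <= T by rewrite /T; lra.
exists T, g, phi, t1, s1; split; rewrite ?t10 ?s10//; last first.
  by split=> // t /andP[_ tt]; exact: E1.
have subI u : `[0, t1]%classic u -> `[0, T1]%classic u.
  by rewrite /= !in_itv/= => /andP[-> ut]; apply: le_trans t1T.
have shift u : t1 <= u -> u <= T -> 0 <= u - t1 + s1 <= T2.
  by rewrite /T => h1 h2; apply/andP; split; lra.
have inj1 u v : 0 <= u <= t1 -> 0 <= v <= t1 -> g1 u = g1 v -> u = v.
  by move=> hu hv; apply: i1; rewrite inE; apply: subI; rewrite /= in_itv.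
have injx u v : 0 <= u -> u <= t1 -> t1 < v -> v <= T -> g u = g v -> u = v.
  move=> u0 ut vt vT; have [-> _] := E1 _ ut; have [-> _] := E2 _ (ltW vt).
  move=> Euv; have hv := shift v (ltW vt) vT.
  (* Before t1 there is no meeting by minimality. At t1 itself injectivity of g2 decides. *)
  move: ut; rewrite le_eqVlt => /orP[/eqP ut|ut]; last by case: (hit _ _ u0 ut hv).
  rewrite ut Es in Euv.
  have : s1 = v - t1 + s1 by apply: i2 => //; rewrite inE/= in_itv/= ?s10.
  lra.
split.
- split.
  + exact: le_trans t1T'.
  + have -> : `[0, T]%classic = `[0, t1]%classic `|` `[t1, T]%classic.
      apply/seteqP; split=> u /=; rewrite !in_itv/=.
        by move=> /andP[u0 uT]; have [ut|ut] := leP u t1; [left|right]; rewrite ?u0// ltW.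
      by case=> /andP[h1 h2]; apply/andP; split; lra.
    apply: withinU_continuous; [exact: interval_closed|exact: interval_closed| |].
      apply: (@subspace_eq_continuous _ _ _ g1).
        by move=> u; rewrite inE/= in_itv/= => /andP[_ /E1[]].
      exact: continuous_subspaceW c1.
    apply: (@subspace_eq_continuous _ _ _ (g2 \o (fun u => u - t1 + s1))).
      by move=> u; rewrite inE/= in_itv/= => /andP[/E2[]].
    apply: within_continuous_reparam c2.
      move=> u; apply: cvgD; last exact: cvg_cst.
      by apply: cvgB; [exact: cvg_id|exact: cvg_cst].
    by move=> u /=; rewrite !in_itv/= => /andP[h1 h2]; apply: shift.
  + move=> u v; rewrite !inE/= !in_itv/= => /andP[u0 uT] /andP[v0 vT].
    have [ut|ut] := leP u t1; have [vt|vt] := leP v t1.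
    * have [-> _] := E1 _ ut; have [-> _] := E1 _ vt.
      by apply: inj1; apply/andP.
    * exact: injx.
    * by move=> /esym h; apply/esym; exact: injx.
    * have [-> _] := E2 _ (ltW ut); have [-> _] := E2 _ (ltW vt) => h.
      have hu := shift u (ltW ut) uT; have hv := shift v (ltW vt) vT.
      have := i2 _ _ _ _ h; rewrite !inE/= !in_itv/= hu hv.
      by move=> /(_ isT isT); lra.
  + split; first by have [-> _] := E1 _ t10.
    have [-> _] := E2 _ t1T'; rewrite -g2T; congr g2; rewrite /T; ring.
  + move=> _ [u + <-]; rewrite /= in_itv/= => /andP[u0 uT].
    have [ut|ut] := leP u t1.
      have [-> _] := E1 _ ut; apply: A1; exists u => //=.
      by rewrite in_itv/= u0 (le_trans ut).
    have [-> _] := E2 _ (ltW ut); apply: A2; exists (u - t1 + s1) => //=.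
    by rewrite in_itv/= shift// ltW.
- by have [_ ->] := E1 _ t10.
move=> s t s0 st tT.
have q2 u v : t1 <= u -> u <= v -> v <= T ->
    mdist (g u) (g v) <= phi v - phi u.
  move=> tu uv vT; have [-> ->] := E2 _ tu; have [-> ->] := E2 _ (le_trans tu uv).
  have /andP[h1 h2] := shift u tu (le_trans uv vT).
  have /andP[h3 h4] := shift v (le_trans tu uv) vT.
  have := p2 (u - t1 + s1) (v - t1 + s1) h1; rewrite lerD2r lerD2r => /(_ uv h4).
  lra.
have q1 u v : 0 <= u -> u <= v -> v <= t1 -> mdist (g u) (g v) <= phi v - phi u.
  move=> u0 uv vt; have [-> ->] := E1 _ vt; have [-> ->] := E1 _ (le_trans uv vt).
  by apply: p1 => //; apply: le_trans t1T.
have [tt|tt] := leP t t1; first exact: q1.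
have [ss|ss] := leP s t1; last by apply: q2 => //; exact: ltW.
have h1 := q1 s t1 s0 ss (lexx _); have h2 := q2 t1 t (lexx _) (ltW tt) tT.
have := metric_triangle (g s) (g t1) (g t); lra.
Qed.

(** Each point of the arc is assigned to the piece i it comes from. Cutting off loops only decreases
    the lengths on both sides, so the bounds by partial sums survive each concatenation. *)
Lemma chain_arc (R : realType) (X : metricType R) (A : set X) (z : nat -> X)
    (l : nat -> R) (n : nat) :
  A (z 0%N) -> (forall i, 0 <= l i) ->
  (forall i, (i < n)%N -> exists T g phi,
     controlled_arc A (z i) (z i.+1) T g phi /\ phi T <= l i) ->
  exists T g phi, [/\ controlled_arc A (z 0%N) (z n) T g phi,
    phi T <= \sum_(j < n) l j &
    forall t, 0 <= t <= T -> exists i, [/\ (i <= n)%N,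
      phi t <= \sum_(j < i.+1) l j, phi T - phi t <= \sum_(i <= j < n) l j &
      mdist (z i) (g t) <= l i]].
Proof.
move=> A0 l0; elim: n => [|n IH] H.
  exists 0, (fun=> z 0%N), (fun=> 0); split.
  - split=> //; last by move=> *; rewrite mdistxx subrr.
    split=> //.
    + by move=> x; exact: cvg_cst.
    + move=> u v; rewrite !inE/= !in_itv/= => /andP[u0 u1] /andP[v0 v1] _; lra.
    + by move=> _ [u _ <-].
  - by rewrite big_ord0.
  - move=> t _; exists 0%N; split=> //; rewrite ?mdistxx//.
      by rewrite big_ord_recl big_ord0 addr0.
    by rewrite big_geq// subrr.
have [T1 [g1 [phi1 [c1 l1 H1]]]] : exists T g phi, [/\ controlled_arc A (z 0%N) (z n) T g phi,
    phi T <= \sum_(j < n) l j &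
    forall t, 0 <= t <= T -> exists i, [/\ (i <= n)%N,
      phi t <= \sum_(j < i.+1) l j, phi T - phi t <= \sum_(i <= j < n) l j &
      mdist (z i) (g t) <= l i]].
  by apply: IH => i iin; apply: H; exact: ltnW.
have [T2 [g2 [phi2 [c2 l2]]]] := H n (leqnn _).
have [T [g [phi [t1 [s1 [cg /andP[t10 t1T] /andP[s10 s1T] TE [E1 E2]]]]]]] := arc_cat c1 c2.
have [_ _ p1] := c1.
have [[_ _ _ [g20 _] _] p20 p2] := c2.
have m1 u v : 0 <= u -> u <= v -> v <= T1 -> phi1 u <= phi1 v.
  move=> u0 uv vT; have := p1 u v u0 uv vT; have := mdist_ge0 (g1 u) (g1 v); lra.
have m2 u v : 0 <= u -> u <= v -> v <= T2 -> phi2 u <= phi2 v.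
  move=> u0 uv vT; have := p2 u v u0 uv vT; have := mdist_ge0 (g2 u) (g2 v); lra.
have t1T' : t1 <= T by lra.
have phiT : phi T = phi1 t1 + (phi2 T2 - phi2 s1).
  have [_ ->] := E2 _ t1T'; congr (_ + (phi2 _ - _)); rewrite TE; ring.
have h1 := m1 t1 T1 t10 t1T (lexx _).
have h2 := m2 0 s1 (lexx _) s10 s1T; rewrite p20 in h2.
exists T, g, phi; split=> //.
  by rewrite big_ord_recr/= phiT; lra.
move=> t /andP[t0 tT]; have [tt|tt] := leP t t1.
  have [-> pt] := E1 t ltac:(by rewrite t0).
  have [i [iin b1 b2 b3]] := H1 t ltac:(by rewrite t0 (le_trans tt)).
  exists i; split=> //; [exact: leqW|by rewrite pt|].
  by rewrite big_nat_recr//= phiT pt; lra.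
have [gt pt] := E2 t (ltW tt).
have r0 : 0 <= t - t1 + s1 by lra.
have r1 : t - t1 + s1 <= T2 by lra.
have h3 := m2 _ _ r0 r1 (lexx _).
exists n; split=> //.
- by rewrite big_ord_recr/= pt; lra.
- rewrite big_nat1 phiT pt.
  have := m2 s1 (t - t1 + s1) s10 _ r1; lra.
- rewrite gt; have := p2 0 _ (lexx _) r0 r1; rewrite g20 p20; lra.
Qed.

(** * Uniformity from chains, and the theorem *)

Lemma quasiconvex_le (R : realType) (c c' : R) (X : metricType R) :
  c <= c' -> quasiconvex c X -> quasiconvex c' X.
Proof.
move=> cc [c1 H]; split; first exact: le_trans cc.
move=> x y; have [T [g [gA gL]]] := H x y; exists T, g; split=> //.
by apply: le_trans gL _; rewrite lee_fin ler_wpM2r// mdist_ge0.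
Qed.

Lemma uniform_domain_le (R : realType) (b b' : R) (X : metricType R)
    (U : set X) : b <= b' -> uniform_domain b U -> uniform_domain b' U.
Proof.
move=> bb [dU UT H]; split=> // x y Ux Uy.
have [T [g [gA gr gc gL]]] := H x y Ux Uy; exists T, g; split=> //.
  move=> t tT; apply: le_trans (gc t tT) _.
  by rewrite lee_fin ler_wpM2r// bdist_ge0.
by apply: le_trans gL _; rewrite lee_fin ler_wpM2r// mdist_ge0.
Qed.

(** At this scale the upper estimate [qh_dist_le] in G, multiplied by M, is at most 1/4, so the
    minimum in [le_qh_dist] for G' is its second term. *)
Lemma qh_scaled_lip (R : realType) (X Y : metricType R) (c M : R) (G : set X)
    (G' : set Y) (f : X -> Y) :
  1 <= M -> quasiconvex c X -> open G -> boundary G !=set0 ->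
  open G' -> boundary G' !=set0 -> (forall x, G x -> G' (f x)) ->
  (forall x y, G x -> G y ->
    (qh_dist G' (f x) (f y) <= M%:E * qh_dist G x y)%E) ->
  scaled_lip (4 * c * M) G G' f.
Proof.
move=> M1 qX oG BG oG' BG' fG H x y Gx Gy xy; have [c1 _] := qX.
have d0 := bdist_gt0 oG BG Gx; have d'0 := bdist_gt0 oG' BG' (fG _ Gx).
have t0 := mdist_ge0 x y; have t'0 := mdist_ge0 (f x) (f y).
have ct0 : 0 <= c * mdist x y by rewrite mulr_ge0//; lra.
have xy2 : 2 * c * mdist x y <= bdist G x.
  apply: le_trans xy.
  have -> : 2 * (4 * c * M) * mdist x y = 8 * M * (c * mdist x y) by ring.
  by rewrite -mulrA; nra.
have h1 := qh_dist_le qX oG Gx d0 xy2.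
have h2 := le_qh_dist (f y) oG' BG' (fG _ Gx).
have M0 : (0 <= M%:E)%E by rewrite lee_fin; lra.
have := le_trans h2 (le_trans (H x y Gx Gy) (lee_wpmul2l M0 h1)).
rewrite -EFinM lee_fin ge_min => /orP[|].
  rewrite mulrA ler_pdivlMr// => h; exfalso.
  have : bdist G x <= 0 by lra.
  by rewrite leNgt d0.
rewrite mulrA ler_pdivlMr// mulrAC ler_pdivrMr ?mulr_gt0//.
move=> h; lra.
Qed.

Lemma open_preimage_within (T U : topologicalType) (A : set T) (B : set U)
    (f : T -> U) : open A -> open B -> {within A, continuous f} ->
  open (A `&` f @^-1` B).
Proof.
move=> oA oB /subspace_continuousP cf; rewrite openE => x [Ax Bx].
have nB : nbhs (f x) B by apply: open_nbhs_nbhs.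
have h : nbhs x (fun y => A y -> B (f y)) := cf x Ax B nB.
have nA : nbhs x A by apply: open_nbhs_nbhs.
by apply: filterS2 nA h => y Ay hy; split=> //; exact: hy.
Qed.

(** A shortest chain satisfies the hypotheses of [geodesic_chain]. The ratio 1 / (2 c) makes the
    quasiconvex arcs filling its steps at most half the boundary distance long, so they stay in
    D. *)
Lemma uniform_of_chain (R : realType) (c q C : R) (p : nat) :
  1 <= c -> 1 < q -> 1 <= C -> exists b' : R,
  forall (Y : metricType R) (D : set Y), quasiconvex c Y -> domain D ->
    D <> setT ->
    (forall x y, D x -> D y -> exists2 n, chain (step D (2 * c)^-1) n x y &
       q ^+ n <= C *
         (1 + mdist x y / Order.min (bdist D x) (bdist D y)) ^+ p) ->
    uniform_domain b' D.
Proof.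
move=> c1 q1 C1; set eps := (2 * c)^-1.
have c0 : 0 < 2 * c by lra.
have e0 : 0 < eps by rewrite invr_gt0.
have ce : c * eps = 2^-1 by rewrite /eps invfM mulrCA divff ?mulr1//; lra.
have e1 : eps <= 1 by rewrite invf_le1//; lra.
have [C' C'1 geo] := geodesic_chain p q1 C1 e0 e1.
(* C' serves long chains and the cigar condition, c the chains of a single step. *)
exists (c + C') => Y D qY dD DT H; split=> // x y Dx Dy.
have BD := quasiconvex_boundary qY dD DT; have [_ oD _] := dD.
have dpos y' : D y' -> 0 < bdist D y' by apply: bdist_gt0.
have [n0 ch0 _] := H x y Dx Dy.
have Pex : exists n, `[< chain (step D eps) n x y >] by exists n0; exact/asboolP.
case: (ex_minnP Pex) => n /asboolP[z [z0 zn zstep]] nmin.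
have nmin' m : chain (step D eps) m x y -> (n <= m)%N.
  by move=> h; apply: nmin; exact/asboolP.
have Dz i : (i <= n)%N -> D (z i).
  case: i => [_|i iin]; first by rewrite z0.
  by have [] := zstep i iin.
have sub i j : (i <= j)%N -> (j <= n)%N -> chain (step D eps) (j - i) (z i) (z j).
  move=> ij jn; exists (fun k => z (i + k)%N); split; rewrite ?addn0 ?subnKC//.
  by move=> k kji; rewrite addnS; apply: zstep; lia.
have zgeo i j : (i <= j)%N -> (j <= n)%N ->
    q ^+ (j - i) <= C * (1 + mdist (z i) (z j) /
                             Order.min (bdist D (z i)) (bdist D (z j))) ^+ p.
  move=> ij jn; have iin := leq_trans ij jn.
  have [m chm hm] := H _ _ (Dz i iin) (Dz j jn).
  apply: le_trans hm; rewrite ler_weXn2l ?ltW//.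
  (* Replacing the part from z i to z j by the chain of length m cannot shorten a shortest chain, so
     j - i <= m. *)
  have h1 := sub 0%N i (leq0n _) iin; have h2 := sub j n jn (leqnn _).
  rewrite z0 in h1; rewrite zn in h2.
  have := nmin' _ (chain_cat h1 (chain_cat chm h2)); lia.
have [cig tot] := geo Y D z n dpos Dz zstep zgeo.
(* No arc starts at the last point, so l vanishes from n on. *)
pose l i := if (i < n)%N then c * mdist (z i) (z i.+1) else 0.
have l0 i : 0 <= l i.
  by rewrite /l; case: ifP => // _; rewrite mulr_ge0 ?mdist_ge0//; lra.
have la i : l i <= 2^-1 * bdist D (z i).
  rewrite /l; case: ifP => [iin|_]; last by rewrite mulr_ge0 ?bdist_ge0.
  by rewrite -ce -mulrA ler_pM2l; [have [] := zstep i iin | lra].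
have lsum i j : \sum_(i <= k < j) l k <= 2^-1 * \sum_(i <= k < j) bdist D (z k).
  by rewrite mulr_sumr; apply: ler_sum => k _.
have arcs i : (i < n)%N -> exists T g phi,
    controlled_arc D (z i) (z i.+1) T g phi /\ phi T <= l i.
  move=> iin; have [_ qc] := qY.
  have [T [g [[T0 cg gi [g0 gT] _] gL]]] := qc (z i) (z i.+1).
  have Ag : arc_in D (z i) (z i.+1) T g.
    split=> //; apply: (path_subset oD cg gL); rewrite g0; first exact/Dz/ltnW.
    have := la i; rewrite /l iin; have := dpos _ (Dz i (ltnW iin)); lra.
  have [phi cphi phiT] := arc_controlled Ag gL.
  by exists T, g, phi; rewrite /l iin.
have Dz0 : D (z 0%N) by apply: Dz.
have [T [g [phi [carc phiT Hg]]]] := chain_arc Dz0 l0 arcs.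
rewrite z0 zn in carc; have [Ag phi0 pg] := carc.
have [T0 _ _ _ _] := Ag.
have len : (path_length g 0 T <= ((c + C') * mdist x y)%:E)%E.
  apply: le_trans (path_length_le pg) _; rewrite phi0 subr0 lee_fin.
  apply: (le_trans phiT); have r0 := mdist_ge0 x y.
  have cr0 : 0 <= c * mdist x y by rewrite mulr_ge0//; lra.
  have Cr0 : 0 <= C' * mdist x y by rewrite mulr_ge0//; lra.
  have [n1|n2] := leqP n 1.
    move: n1; rewrite leq_eqVlt ltnS leqn0 => /orP[]/eqP nE; rewrite nE.
      rewrite big_ord_recl big_ord0 addr0 /l nE/= z0.
      by rewrite nE in zn; rewrite zn mulrDl lerDl.
    by rewrite big_ord0 mulrDl addr_ge0.
  have nst : ~ step D eps (z 0%N) (z n).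
    by rewrite z0 zn => h; have := nmin' _ (chain1 h); rewrite leqNgt n2.
  have := tot nst; rewrite z0 zn => h.
  have := lsum 0%N n; rewrite !big_mkord => h1.
  rewrite big_ord_recr/= in h; have := bdist_ge0 D (z n); lra.
exists T, g; split=> //.
  by apply: le_lt_trans len _; rewrite ltry.
move=> t; rewrite in_itv/= => /andP[t0 tT].
have [i [iin h1 h2 h3]] := Hg t ltac:(by rewrite t0).
have ai := dpos _ (Dz i iin).
have dgt : bdist D (z i) / 2 <= bdist D (g t).
  have := bdist_lip D (z i) (g t); have := la i; lra.
have bnd : C' * (bdist D (z i) / 2) <= (c + C') * bdist D (g t).
  by apply: ler_pM => //; lra.
rewrite ge_min; apply/orP; have [h|h] := cig i iin; [left|right].
  apply: (@le_trans _ _ (phi t - phi 0)%:E).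
    by apply: path_length_le => u v u0 uv vt; apply: pg => //; apply: le_trans tT.
  rewrite phi0 subr0 lee_fin; apply: le_trans bnd.
  have := lsum 0%N i.+1; rewrite !big_mkord; lra.
apply: (@le_trans _ _ (phi T - phi t)%:E).
  by apply: path_length_le => u v u0 uv vt; apply: pg => //; apply: le_trans u0.
rewrite lee_fin; apply: le_trans bnd.
rewrite big_nat_recr//= in h; have := bdist_ge0 D (z n).
have := lsum i n; lra.
Qed.

Theorem theorem3 (R : realType) (cX cY a a' b1 b2 M : R) (M_ge1 : 1 <= M) :
  exists b' : R,
    forall (X Y : metricType R) (G : set X) (G' : set Y) (f : X -> Y)
           (D : set X),
      complete_space X -> quasiconvex cX X ->
      complete_space Y -> quasiconvex cY Y ->
      domain G -> G <> setT -> non_point_cut G -> locally_john a G ->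
      uniform_domain b1 G' -> locally_john a' G' ->
      quasihyperbolic M G G' f ->
      D `<=` G -> uniform_domain b2 D ->
      uniform_domain b' (f @` D).
Proof.
(* Common constants for both spaces and both uniform domains, at least 1 even before quasiconvexity
   is assumed. *)
pose c := Order.max 1 (Order.max cX cY).
pose b := Order.max 1 (Order.max b1 b2).
have c1 : 1 <= c by rewrite /c le_max lexx.
have cXc : cX <= c by rewrite /c !le_max lexx orbT.
have cYc : cY <= c by rewrite /c !le_max lexx !orbT.
have bb1 : 1 <= b by rewrite /b le_max lexx.
have b1b : b1 <= b by rewrite /b !le_max lexx orbT.
have b2b : b2 <= b by rewrite /b !le_max lexx !orbT.
clearbody c b.
have cl : c <= 4 * c * M by nra.
have e0 : 0 < (2 * c)^-1 by rewrite invr_gt0; lra.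
have e1 : (2 * c)^-1 <= 1 by rewrite invf_le1; lra.
have [q [C [p [q1 C1 chains]]]] := image_chain c1 bb1 cl e0 e1.
have [b' unif] := uniform_of_chain p c1 q1 C1.
exists b' => X Y G G' f D _ /(quasiconvex_le cXc) qX _ /(quasiconvex_le cYc) qY.
move=> dG GT _ _ /(uniform_domain_le b1b) uG' _ [[g [fG gG' fK gK [cf cg]]] qh].
move=> DG /(uniform_domain_le b2b) uD.
have [dG' G'T _] := uG'; have [dD DT _] := uD.
have [_ oG _] := dG; have [_ oG' _] := dG'; have [[x0 Dx0] oD cD] := dD.
have fG1 x : G x -> G' (f x) by move=> Gx; apply: fG; exists x.
have gG1 y : G' y -> G (g y) by move=> Gy; apply: gG'; exists y.
have gf x : G x -> g (f x) = x by move=> Gx; apply: fK; rewrite inE.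
have fg y : G' y -> f (g y) = y by move=> Gy; apply: gK; rewrite inE.
have D'G' : f @` D `<=` G' by move=> _ [x /DG Gx <-]; exact: fG1.
(* This form of the image makes it open, by continuity of g on G'. *)
have D'E : f @` D = G' `&` g @^-1` D.
  apply/seteqP; split=> [_ [x Dx <-]|y [Gy Dgy]].
    by split; [exact/fG1/DG | rewrite /= gf//; exact: DG].
  by exists (g y) => //; exact: fg.
have dD' : domain (f @` D).
  split; first by exists (f x0); exists x0.
    by rewrite D'E; exact: open_preimage_within.
  by apply: connected_continuous_connected => //; apply: continuous_subspaceW cf.
have [_ oD' _] := dD'.
have D'T : f @` D <> setT.
  by move=> E; apply: G'T; apply/seteqP; split=> // y _; apply: D'G'; rewrite E.
have BG := quasiconvex_boundary qX dG GT.
have BD := quasiconvex_boundary qX dD DT.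
have BG' := quasiconvex_boundary qY dG' G'T.
have BD' := quasiconvex_boundary qY dD' D'T.
apply: unif => //.
apply: (chains X Y G D G' (f @` D) f g) => //; split=> //.
- move=> x Gx; split=> [Dx|]; first by exists x.
  by rewrite D'E => -[_]; rewrite /= gf.
- apply: qh_scaled_lip => // x y Gx Gy.
  by have [] := qh x y Gx Gy.
- by move=> y Gy; rewrite D'E; split=> [[]|].
- apply: qh_scaled_lip => // x y Gx Gy.
  (* The lower quasihyperbolic bound for f is the upper one for g. *)
  have [h _] := qh _ _ (gG1 _ Gx) (gG1 _ Gy); rewrite !fg// in h.
  by rewrite -lee_pdivrMl//; lra.
Qed.
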